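(* Let $0<r<1$, and for $\lambda>0$ let $Z_\lambda^{QW}:=\dfrac{P_\lambda^{QW}-\lambda I}{\sqrt{\lambda\omega_1}}$. Then $D_{\sqrt{\omega_1}}(\mu_{Z_\lambda^{QW}})$ converges weakly to the Konno distribution $\mathrm K_r$ as $\lambda\to\infty$.
   Context: Fix $r\in(0,1)$ and let $\omega_1=1-\sqrt{1-r^2}$, $\omega_2=\frac{\sqrt{1-r^2}}{2}\omega_1$, $\omega=\frac{r^2}{4}$, and $\omega_n=\omega$ for $n\ge3$. Let $\mathcal H$ be a complex Hilbert space with complete orthonormal system $\{\Phi_n\}_{n\ge0}$, and let $B_+^{QW},B_-^{QW}$ be the bounded operators with $B_+^{QW}\Phi_n=\sqrt{\omega_{n+1}}\,\Phi_{n+1}$ ($n\ge0$), $B_-^{QW}\Phi_n=\sqrt{\omega_n}\,\Phi_{n-1}$ ($n\ge1$), $B_-^{QW}\Phi_0=0$; they are mutually adjoint. For $\lambda>0$ put $P_\lambda^{QW}=(B_+^{QW}+\sqrt\lambda I)(B_-^{QW}+\sqrt\lambda I)$. For a bounded self-adjoint $T$ with spectral measure $E_T$, $\mu_T(B)=\langle\Phi_0,E_T(B)\Phi_0\rangle$. $D_c(\mu)$ is the dilation of $\mu$, i.e. the push-forward of $\mu$ under $x\mapsto cx$. The (symmetric) Konno distribution is $$\mathrm K_r(dx)=\frac{\sqrt{1-r^2}}{\pi(1+x^2)\sqrt{r^2-x^2}}\mathbf 1_{(-r,r)}(x)\,dx$$ with $1+x^2$ replaced by $1-x^2$; equivalently,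 it is the probability measure with Cauchy transform $$\int\frac{\mathrm K_r(dx)}{z-x}=\frac{z(z^2-r^2)-\sqrt{1-r^2}\sqrt{z^2-r^2}}{(z^2-1)(z^2-r^2)},$$ and with Jacobi parameters: diagonal parameters all $0$, off-diagonal parameters $\omega_1,\omega_2,\omega,\omega,\dots$. *)

(* Defs.v *)
From HB Require Import structures.
From mathcomp Require Import all_boot all_order all_algebra.
From mathcomp Require Import complex.
From mathcomp Require Import all_classical all_reals all_analysis.
From mathcomp Require Import measurable_realfun.
From mathcomp Require Import ring lra.

Set Implicit Arguments.
Unset Strict Implicit.
Unset Printing Implicit Defensive.

Import Order.TTheory GRing.Theory Num.Def Num.Theory.
Import numFieldNormedType.Exports.

Local Open Scope classical_set_scope.
Local Open Scope ring_scope.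
Local Open Scope complex_scope.

(* [inner] is linear in its first argument and conjugate-linear in the second. *)
HB.mixin Record CompleteNormedModule_isHilbert (R : realType) H
    & CompleteNormedModule R[i] H := {
  inner : {dot H for (@Num.conj R[i])} ;
  normr_inner : forall x : H, `|x| ^+ 2 = inner x x }.

#[short(type="hilbertType")]
HB.structure Definition Hilbert (R : realType) :=
  {H of CompleteNormedModule R[i] H & CompleteNormedModule_isHilbert R H}.

Definition complete_orthonormal (R : realType) (H : hilbertType R)
    (Phi : nat -> H) :=
  (forall m n, inner (Phi m) (Phi n) = (m == n)%:R) /\
  (forall x : H, (forall n, inner x (Phi n) = 0) -> x = 0).

(* Projection-valued measures on the Borel sets of R; [pvm_fun A] is the junk
   value 0 when A is not Borel. Boundedness of the projections is automatic,
   and so is multiplicativity. *)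
Record pvm (R : realType) (H : hilbertType R) := Pvm {
  pvm_fun :> set (measurableTypeR R) -> {linear H -> H} ;
  pvm_nmeas : forall A x, ~ measurable A -> pvm_fun A x = 0 ;
  pvm_idem : forall A x, pvm_fun A (pvm_fun A x) = pvm_fun A x ;
  pvm_selfadj : forall A x y,
    inner (pvm_fun A x) y = inner x (pvm_fun A y) ;
  pvm_set0 : forall x, pvm_fun set0 x = 0 ;
  pvm_setT : forall x, pvm_fun setT x = x ;
  pvm_sigma_additive : forall (F : (set (measurableTypeR R))^nat) x,
    (forall n, measurable (F n)) -> trivIset setT F ->
    (fun n => \sum_(0 <= i < n) pvm_fun (F i) x) @ \oo
      --> pvm_fun (\bigcup_n F n) x }.

(* The scalar <x, E(A) x> = |E(A) x|^2 is real, so taking Re loses nothing. *)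
Definition pvm_dist (R : realType) (H : hilbertType R) (E : pvm H) (x : H)
    (A : set (measurableTypeR R)) : \bar R :=
  (complex.Re (inner x (E A x)))%:E.

Section pvm_dist_measure.
Context (R : realType) (H : hilbertType R) (E : pvm H) (x : H).

Let pvm_dist0 : pvm_dist E x set0 = 0%E.
Proof. by rewrite /pvm_dist pvm_set0 linear0. Qed.

Let pvm_dist_ge0 A : (0 <= pvm_dist E x A)%E.
Proof.
rewrite /pvm_dist lee_fin -pvm_idem -pvm_selfadj -normr_inner.
have : 0 <= `|E A x| ^+ 2 by rewrite exprn_ge0.
by case: (_ ^+ 2) => a b; rewrite lecE => /andP[].
Qed.

Let inner_polar (y z : H) : complex.Re (inner y z) =
  complex.Re (`|y + z| ^+ 2 - `|y - z| ^+ 2) / 4.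
Proof.
rewrite !normr_inner dnormD dnormB.
case: (inner y z) => a b; case: (inner y y) => c d; case: (inner z z) => e f.
by rewrite /=; field.
Qed.

Let cvg_Re (u : (R[i]^o)^nat) (l : R[i]^o) : u @ \oo --> l ->
  (fun n => complex.Re (u n)) @ \oo --> complex.Re l.
Proof.
move=> ul; apply/cvgrPdist_lt => e e0.
have ec : 0 < e%:C by rewrite ltcR.
move/cvgrPdist_lt : ul => /(_ _ ec); apply: filterS => n.
rewrite -ltcR; apply: le_lt_trans.
by rewrite -raddfB; exact: normc_ge_Re.
Qed.

Let pvm_dist_sigma_additive : semi_sigma_additive (pvm_dist E x).
Proof.
move=> F mF tF mUF.
have := @pvm_sigma_additive _ _ E F x mF tF.
set P := (fun n => _) => PE.
have -> : (fun n => \sum_(0 <= i < n) pvm_dist E x (F i))%E =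
          EFin \o (fun n => complex.Re (inner x (P n))).
  apply/funext => n /=; rewrite /pvm_dist sumEFin; congr EFin.
  by rewrite /P linear_sum raddf_sum.
apply: cvg_EFin; first exact: nearW.
rewrite /pvm_dist /=.
under eq_fun do rewrite inner_polar.
rewrite inner_polar.
apply: cvgMl; apply: cvg_Re; apply: cvgB.
  rewrite expr2; under eq_fun do rewrite expr2.
  by apply: cvgM; apply: cvg_norm; apply: cvgD => //; exact: cvg_cst.
rewrite expr2; under eq_fun do rewrite expr2.
by apply: cvgM; apply: cvg_norm; apply: cvgB => //; exact: cvg_cst.
Qed.

HB.instance Definition _ := isMeasure.Build _ _ _ (pvm_dist E x)
  pvm_dist0 pvm_dist_ge0 pvm_dist_sigma_additive.

End pvm_dist_measure.

(* T = \int t dE(t) in the weak sense, for T defined on all of H. *)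
Definition spectral_measure_of (R : realType) (H : hilbertType R)
    (T : H -> H) (E : pvm H) :=
  forall x, (pvm_dist E x).-integrable setT (EFin : measurableTypeR R -> \bar R) /\
    inner (T x) x = (\int[pvm_dist E x]_t (t : R))%:C.

Definition dilation (R : realType) (c : R)
    (mu : set (measurableTypeR R) -> \bar R) :
    set (measurableTypeR R) -> \bar R :=
  pushforward mu (fun x : measurableTypeR R => (c * x : measurableTypeR R)).

Section dilation_measure.
Context (R : realType) (c : R).
Variable mu : {measure set (measurableTypeR R) -> \bar R}.

Let mf : measurable_fun setT
  (fun x : measurableTypeR R => (c * x : measurableTypeR R)).
Proof. exact: measurable_funM. Qed.

Let dilation0 : dilation c mu set0 = 0%E.
Proof. by rewrite /dilation /pushforward preimage_set0 measure0. Qed.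

Let dilation_ge0 A : (0 <= dilation c mu A)%E.
Proof. exact: measure_ge0. Qed.

Let dilation_sigma_additive : semi_sigma_additive (dilation c mu).
Proof.
move=> F mF tF mUF; rewrite /dilation /pushforward preimage_bigcup.
apply: measure_semi_sigma_additive.
- by move=> n; rewrite -[X in measurable X]setTI; exact: mf.
- apply/trivIsetP => /= i j _ _ ij; rewrite -preimage_setI.
  by move/trivIsetP : tF => /(_ _ _ _ _ ij) ->//; rewrite preimage_set0.
- by rewrite -preimage_bigcup -[X in measurable X]setTI; exact: mf.
Qed.

HB.instance Definition _ := isMeasure.Build _ _ _ (dilation c mu)
  dilation0 dilation_ge0 dilation_sigma_additive.

End dilation_measure.

Definition weak_cvg (R : realType) (I : Type) (F : set_system I)
    (mu : I -> {measure set (measurableTypeR R) -> \bar R})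
    (nu : {measure set (measurableTypeR R) -> \bar R}) :=
  forall f : R -> R, continuous f -> bounded_fun f ->
    (\int[mu i]_x (f x)%:E)%E @[i --> F] --> (\int[nu]_x (f x)%:E)%E.

Definition konno_pdf (R : realType) (r x : R) : R :=
  sqrtr (1 - r ^+ 2) / (pi * (1 - x ^+ 2) * sqrtr (r ^+ 2 - x ^+ 2)) *
  \1_(`]- r, r[%classic : set R) x.

Definition konno (R : realType) (r : R) (A : set (measurableTypeR R)) : \bar R :=
  (\int[lebesgue_measure]_(x in A) (konno_pdf r x)%:E)%E.

Section konno_measure.
Context (R : realType) (r : R).

Lemma konno_pdf_ge0 x : 0 <= konno_pdf r x.
Proof.
rewrite /konno_pdf indicE; case: (boolP (x \in _)) => [|_]; last by rewrite mulr0.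
rewrite inE /= in_itv /= => /andP[rx xr]; rewrite mulr1.
have [r1|r1] := leP (1 - r ^+ 2) 0; first by rewrite (ler0_sqrtr r1) mul0r.
rewrite divr_ge0 ?sqrtr_ge0// !mulr_ge0 ?sqrtr_ge0 ?pi_ge0//.
nra.
Qed.

Let measurable_invr : measurable_fun setT (fun x : R => x^-1).
Proof.
rewrite -(setvU [set (0 : R)]); apply/measurable_funU => //.
  exact: measurableC.
split; last exact: measurable_fun_set1.
apply: open_continuous_measurable_fun.
  exact/closed_openC/closed_eq.
by move=> x; rewrite inE /= => /eqP x0; exact: inv_continuous.
Qed.

Lemma measurable_konno_pdf : measurable_fun setT (konno_pdf r).
Proof.
apply: measurable_funM; last by apply: measurable_indic.
apply: measurable_funM => //.
apply: (@measurableT_comp _ _ _ _ _ _ (fun x : R => x^-1)) => //.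
apply: measurable_funM.
  by apply: measurable_funM => //; apply: measurable_funB => //;
    exact: measurable_funX.
apply: (@measurableT_comp _ _ _ _ _ _ (@sqrtr R)).
  by apply: continuous_measurable_fun; exact: sqrt_continuous.
by apply: measurable_funB => //; exact: measurable_funX.
Qed.

Let konno0 : konno r set0 = 0%E.
Proof. by rewrite /konno integral_set0. Qed.

Let konno_ge0 A : (0 <= konno r A)%E.
Proof. by apply: integral_ge0 => x _; rewrite lee_fin konno_pdf_ge0. Qed.

Let konno_sigma_additive : semi_sigma_additive (konno r).
Proof.
move=> F mF tF mUF.
rewrite {2}/konno ge0_integral_bigcup//; last first.
- by move=> x _; rewrite lee_fin konno_pdf_ge0.
- apply: measurable_funTS; apply/measurable_EFinP.
  exact: measurable_konno_pdf.
by apply: is_cvg_ereal_nneg_natsum => n _; exact: konno_ge0.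
Qed.

HB.instance Definition _ := isMeasure.Build _ _ _ (konno r)
  konno0 konno_ge0 konno_sigma_additive.

End konno_measure.

(* Indexed from 1 as in the Jacobi parameters; the value at 0 is never used. *)
Definition omega (R : realType) (r : R) (n : nat) : R :=
  match n with
  | 1 => 1 - sqrtr (1 - r ^+ 2)
  | 2 => sqrtr (1 - r ^+ 2) / 2 * (1 - sqrtr (1 - r ^+ 2))
  | _ => r ^+ 2 / 4
  end.

Definition is_creation (R : realType) (H : hilbertType R) (r : R)
    (Phi : nat -> H) (Bp : {linear H -> H}) :=
  continuous Bp /\
  forall n, Bp (Phi n) = (sqrtr (omega r n.+1))%:C *: Phi n.+1.

Definition is_annihilation (R : realType) (H : hilbertType R) (r : R)
    (Phi : nat -> H) (Bm : {linear H -> H}) :=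
  [/\ continuous Bm, Bm (Phi 0%N) = 0 &
      forall n, Bm (Phi n.+1) = (sqrtr (omega r n.+1))%:C *: Phi n].

Definition PQW (R : realType) (H : hilbertType R) (Bp Bm : {linear H -> H})
    (lambda : R) : H -> H :=
  (fun y => Bp y + (sqrtr lambda)%:C *: y) \o
  (fun x => Bm x + (sqrtr lambda)%:C *: x).

Definition ZQW (R : realType) (H : hilbertType R) (r : R)
    (Bp Bm : {linear H -> H}) (lambda : R) (x : H) : H :=
  ((sqrtr (lambda * omega r 1))^-1)%:C *:
    (PQW Bp Bm lambda x - lambda%:C *: x).

(* Main.v *)
Require Import Defs.
From mathcomp Require Import all_boot all_order all_algebra.
From mathcomp Require Import complex.
From mathcomp Require Import all_classical all_reals all_analysis.
From mathcomp Require Import measurable_realfun.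
From mathcomp Require Import ring lra.
Import Order.TTheory GRing.Theory Num.Def Num.Theory.
Import numFieldNormedType.Exports.
Local Open Scope classical_set_scope.
Local Open Scope ring_scope.

(** Write A = B+ + B-, C = B+ B- and w1 for the first Jacobi parameter. Since
    sqrt(w1) Z_lambda = A + C / sqrt(lambda), the rescaled operators with
    lambda >= 1 are a uniformly bounded family converging strongly to A, and
    the theorem is an instance of the method of moments.

    Spectral side. Only the weak identity <T x, x> = int t d<E x, x> is given,
    for every x, so the higher moments have to be recovered from it. For an
    operator S and a function g with 0 <= <S x, x> = int g d<E x, x> for all x,
    polarization shows that S commutes with the projections E(A), that
    {g < 0} is a null set, and that the spectral distributions of x + S x and
    x - S x differ by 4 |g| times that of x. Integrating |g|^k against that
    relation gives int |g|^k d<E x, x> = <S^k x, x> by induction on k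
    ([spectral_moment]). With S = A + C / sqrt(lambda) + M and M an upper bound
    of all the operators, this places the support in [-M, M] and computes the
    moments about -M ([walk_dist_support], [integral_walk_moment]). They
    converge to <(A + M)^k Phi_0, Phi_0> because S^k Phi_0 converges in norm
    ([cvg_iter_shifted_walk]).

    Konno side. The vectors sqrt(w1 .. wn) Phi_n and the monic polynomials
    P_n with recurrence coefficients omega satisfy the same three-term
    recurrence, for A and for multiplication by x respectively. Both
    <., Phi_0> and the Konno mean send the n-th term to delta_{n0}, so they
    agree on polynomials ([jacobi_moment]). That int P_n dK = 0 for n >= 1
    comes from Chebyshev polynomials T_n in x / r: multiplication of the
    density by 1 - x^2 leaves an arcsine weight, against which the T_n
    integrate to zero for n >= 1; this is a recurrence in steps of
    two for e_n = int T_n dK, with characteristic roots q and 1/q, where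
    q = (1 - s) / (1 + s) and s = sqrt(1 - r^2). As e_n is bounded,
    e_{n+2} = q e_n, while P_{n+2} is a multiple of T_{n+2} - q T_n
    ([konno_mean_monic_ops]).

    Convergence of moments on a fixed segment implies weak convergence by
    Weierstrass approximation ([moments_weak_cvg]). *)

Set Implicit Arguments.
Unset Strict Implicit.
Unset Printing Implicit Defensive.

(** * Measures with a density *)

Section density.
Context d (T : measurableType d) (R : realType).
Variables (mu nu1 nu2 : {measure set T -> \bar R}) (g : T -> R).
Hypotheses (mg : measurable_fun setT g) (g0 : forall x, 0 <= g x).
Hypothesis nuE : forall A, measurable A ->
  nu1 A = (nu2 A + \int[mu]_(x in A) (g x)%:E)%E.

Import HBNNSimple.
Local Open Scope ereal_scope.

Let density_indic (A : set T) : measurable A ->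
  \int[nu1]_x (\1_A x)%:E =
  \int[nu2]_x (\1_A x)%:E + \int[mu]_x ((\1_A x)%:E * (g x)%:E).
Proof.
move=> mA; rewrite !integral_indic// !setIT nuE//; congr (_ + _).
rewrite integral_mkcond; apply: eq_integral => x _; rewrite patchE indicE.
by case: ifPn => xA; rewrite ?mul1e ?mul0e.
Qed.

Let density_nnsfun (f : {nnsfun T >-> R}) :
  \int[nu1]_x (f x)%:E =
  \int[nu2]_x (f x)%:E + \int[mu]_x ((f x)%:E * (g x)%:E).
Proof.
have mk (k : R) : measurable_fun [set: T] (fun x => (k * \1_(f @^-1` [set k]) x)%:E).
  by apply/measurable_EFinP/measurable_funM.
under [LHS]eq_integral do rewrite fimfunE -fsumEFin//.
under [X in _ = X + _]eq_integral do rewrite fimfunE -fsumEFin//.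
under [X in _ = _ + X]eq_integral.
  move=> x _; rewrite fimfunE -fsumEFin// ge0_mule_fsuml; last first.
    by move=> r; rewrite nnfun_muleindic_ge0.
  over.
rewrite !ge0_integral_fsum//;
  do ?[by move=> n x _; rewrite nnfun_muleindic_ge0
      |by move=> n x _; rewrite mule_ge0 ?lee_fin// -lee_fin EFinM nnfun_muleindic_ge0
      |by move=> n; apply: emeasurable_funM => //; exact/measurable_EFinP].
rewrite -fsbig_split//=; apply: eq_fsbigr => r _.
rewrite !integralZl_indic_nnsfun// density_indic//.
have [r0|r0] := leP 0%R r.
  under [X in _ = _ + X]eq_integral do rewrite EFinM -muleA.
  rewrite ge0_integralZl//.
  - by rewrite ge0_muleDr ?integral_ge0// => x _; rewrite ?mule_ge0 ?lee_fin.
  - apply: emeasurable_funM; last exact/measurable_EFinP.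
    exact/measurable_EFinP/measurable_indic.
  - by move=> x _; rewrite mule_ge0 ?lee_fin.
rewrite preimage_nnfun0// indic0 /cst/= !integral0_eq// => [|x _|x _].
- by rewrite adde0 mule0 adde0.
- by rewrite mulr0 mul0e.
- by rewrite mul0e.
Qed.

(** The additive form nu1 = nu2 + g mu serves two purposes: with nu2 = 0 it is
    the change of measure for a density, and with nu1, nu2 the spectral
    distributions of x + S x and x - S x it makes polarization available for
    nonnegative integrands, where no subtraction is allowed. *)
Lemma ge0_integral_density (f : T -> \bar R) :
  measurable_fun setT f -> (forall x, 0 <= f x) ->
  \int[nu1]_x f x = \int[nu2]_x f x + \int[mu]_x (f x * (g x)%:E).
Proof.
move=> mf f0; pose f_ := nnsfun_approx measurableT mf.
have fE x : f x = limn (fun n => (f_ n x)%:E).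
  by apply/esym/cvg_lim => //; exact: cvg_nnsfun_approx.
have mf_ n : measurable_fun setT (fun x => (f_ n x)%:E).
  exact/measurable_EFinP.
have ndf_ x : nondecreasing_seq (fun n => (f_ n x)%:E).
  by move=> m n mn; rewrite lee_fin; exact/lefP/nd_nnsfun_approx.
have mfg n : measurable_fun setT (fun x => (f_ n x)%:E * (g x)%:E).
  by apply: emeasurable_funM => //; exact/measurable_EFinP.
have cvgf (m : {measure set T -> \bar R}) :
    (\int[m]_x (f_ n x)%:E) @[n --> \oo] --> \int[m]_x f x.
  under [in X in _ --> X]eq_integral do rewrite fE.
  by apply: cvg_monotone_convergence => // n x _; rewrite lee_fin.
have cvgfg : (\int[mu]_x ((f_ n x)%:E * (g x)%:E)) @[n --> \oo] -->
    \int[mu]_x (f x * (g x)%:E).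
  have fgE x : f x * (g x)%:E = limn (fun n => (f_ n x)%:E * (g x)%:E).
    apply/esym/cvg_lim => //; apply: cvgeZr => //; exact: cvg_nnsfun_approx.
  under [in X in _ --> X]eq_integral do rewrite fgE.
  apply: cvg_monotone_convergence => //.
    by move=> n x _; rewrite mule_ge0 ?lee_fin.
  move=> x _ m n mn; rewrite lee_wpmul2r ?lee_fin//; exact/lefP/nd_nnsfun_approx.
rewrite -(cvg_lim (@ereal_hausdorff R) (cvgf nu1)).
apply/cvg_lim => //; under eq_fun do rewrite density_nnsfun.
apply: cvgeD => //.
by apply: ge0_adde_def; rewrite inE integral_ge0// => x _; rewrite mule_ge0 ?lee_fin.
Qed.

End density.

(** * Polynomial approximation *)

Section weierstrass.
Context (R : realType).
Implicit Types (f : R -> R) (u v : nat -> R).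

(** Bernstein polynomial of the values u 0, .., u n, built by conditioning on
    the first of n Bernoulli trials; this replaces all binomial sums by
    one-step inductions. *)
Fixpoint bernstein n u : {poly R} :=
  if n is m.+1 then 'X * bernstein m (u \o S) + (1 - 'X) * bernstein m u
  else (u 0%N)%:P.

Lemma bernstein_le n u v x : 0 <= x <= 1 ->
  (forall k, (k <= n)%N -> u k <= v k) -> (bernstein n u).[x] <= (bernstein n v).[x].
Proof.
move=> /andP[x0 x1]; elim: n u v => [|n IHn] u v uv /=.
  by rewrite !hornerC uv.
rewrite !hornerE lerD// ler_wpM2l ?subr_ge0//; apply: IHn => k kn; apply: uv => //.
exact: leqW.
Qed.

(** Mean and variance of a binomial variable in a single identity: keeping the
    centre c arbitrary makes the induction close. *)
Lemma bernstein_quadratic n (a b c x : R) :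
  (bernstein n (fun k => a + b * (k%:R - c) ^+ 2)).[x] =
  a + b * ((n%:R * x - c) ^+ 2 + n%:R * x * (1 - x)).
Proof.
elim: n c => [|n IHn] c /=; first by rewrite hornerC !mul0r addr0.
rewrite !hornerE IHn.
have -> : (fun k => a + b * (k%:R - c) ^+ 2) \o S =
          (fun k => a + b * (k%:R - (c - 1)) ^+ 2).
  by apply/funext => k /=; rewrite -natr1; congr (_ + _ * _ ^+ 2); ring.
by rewrite IHn -natr1; ring.
Qed.

(** Heine's theorem. *)
Lemma uniform_continuity_segment f (a b e : R) : {within `[a, b], continuous f} ->
  0 < e -> exists2 d, 0 < d & forall x y, x \in `[a, b] -> y \in `[a, b] ->
    `|x - y| < d -> `|f x - f y| < e.
Proof.
move=> cf e0.
have e20 : 0 < e / 2 by rewrite divr_gt0.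
have : \forall d \near 0^'+, forall x, `[a, b]%classic x ->
    forall y, `[a, b]%classic y -> `|x - y| < d -> `|f x - f y| < e.
  have /compact_near_coveringP/near_covering_withinP := @segment_compact R a b.
  apply => x xab.
  have fx : f z @[z --> within `[a, b]%classic (nbhs x)] --> f x.
    by move/subspace_continuousP : cf; exact.
  move/cvgrPdist_lt : fx => /(_ _ e20); rewrite near_withinE.
  move=> /nbhs_ballP[eta /= eta0 xeta].
  have eta20 : 0 < eta / 2 by rewrite divr_gt0.
  exists ([set z | `|x - z| < eta / 2], [set d | d < eta / 2]).
    split; first by apply/nbhs_ballP; exists (eta / 2).
    exact: nbhs_right_lt.
  move=> [z d] /= [xz deta] zab y yab zy.
  have xy : `|x - y| < eta by have := ler_distD z x y; lra.
  have h1 := xeta _ xy yab.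
  have h2 : `|f x - f z| < e / 2.
    by apply: xeta => //; rewrite /ball /=; lra.
  by have := ler_distD (f x) (f z) (f y); rewrite (distrC (f z) (f x)); lra.
move=> fd; have [d [d0 {}fd]] := filter_ex (filterI (nbhs_right_gt (0 : R)) fd).
by exists d => // x y xab yab; exact: fd.
Qed.

(** Bernstein's argument: f (k / n) differs from f x by at most e / 2 when k / n
    is within d of x, and by at most K (k / n - x)^2 otherwise, so the error is
    controlled by the variance, which is at most 1 / n. *)
Lemma weierstrass01 f e : continuous f -> 0 < e ->
  exists p : {poly R}, forall x, 0 <= x <= 1 -> `|f x - p.[x]| <= e.
Proof.
move=> cf e0; have e20 : 0 < e / 2 by rewrite divr_gt0.
have [d d0 fd] := @uniform_continuity_segment f 0 1 _ (continuous_subspaceT cf) e20.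
have /compact_bounded[M [_ fM]] :=
  continuous_compact (continuous_subspaceT cf) (@segment_compact R 0 1).
have {}fM := fM (`|M| + 1) (le_lt_trans (ler_norm M) (ltr_pwDr ltr01 (lexx _))).
set M1 := `|M| + 1 in fM.
have M10 : 0 < M1 by rewrite ltr_wpDl.
have fM1 x : 0 <= x <= 1 -> `|f x| <= M1.
  by move=> x01; apply: fM; exists x => //=; rewrite in_itv.
pose K := 2 * M1 / d ^+ 2.
have K0 : 0 < K by rewrite divr_gt0 ?mulr_gt0 ?exprn_gt0.
pose n := (Num.truncn (K / (e / 2))).+1.
have n0 : 0 < n%:R :> R by rewrite ltr0n.
have Kn : K / n%:R <= e / 2.
  by rewrite ler_pdivrMr// mulrC -ler_pdivrMr// ltW// truncnS_gt.
exists (bernstein n (fun k => f (k%:R / n%:R))) => x x01.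
have fK k : (k <= n)%N ->
    `|f (k%:R / n%:R) - f x| <= e / 2 + K / n%:R ^+ 2 * (k%:R - n%:R * x) ^+ 2.
  move=> kn; have kn01 : 0 <= (k%:R / n%:R : R) <= 1.
    by apply/andP; split; [exact: divr_ge0|rewrite ler_pdivrMr// mul1r ler_nat].
  have knE : K / n%:R ^+ 2 * (k%:R - n%:R * x) ^+ 2 = K * (k%:R / n%:R - x) ^+ 2.
    by field; rewrite gt_eqF.
  rewrite knE; have [kx|kx] := ltP `|k%:R / n%:R - x| d.
    by rewrite (le_trans (ltW (fd _ _ _ _ kx)))// ?in_itv// lerDl mulr_ge0 ?sqr_ge0// ltW.
  have Kd : 2 * M1 <= K * (k%:R / n%:R - x) ^+ 2.
    rewrite /K mulrAC ler_pdivlMr ?exprn_gt0// ler_pM2l ?mulr_gt0//.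
    by rewrite -[leRHS]real_normK ?num_real// lerXn2r ?nnegrE ?(ltW d0).
  have := ler_normB (f (k%:R / n%:R)) (f x); have := fM1 _ kn01; have := fM1 _ x01.
  by lra.
have Bq b : (bernstein n (fun k => f x + b * (e / 2) +
      (b * (K / n%:R ^+ 2)) * (k%:R - n%:R * x) ^+ 2)).[x]
   = f x + b * (e / 2 + K / n%:R * (x * (1 - x))).
  by rewrite bernstein_quadratic; field; rewrite gt_eqF.
have Kx : K / n%:R * (x * (1 - x)) <= e / 2.
  rewrite (le_trans _ Kn)// ler_piMr ?divr_ge0 ?ltW//; nra.
have l1 : f x + -1 * (e / 2 + K / n%:R * (x * (1 - x))) <=
    (bernstein n (fun k => f (k%:R / n%:R))).[x].
  rewrite -Bq; apply: bernstein_le => // k /fK.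
  by rewrite ler_norml => /andP[+ _]; rewrite !mulN1r mulNr; lra.
have l2 : (bernstein n (fun k => f (k%:R / n%:R))).[x] <=
    f x + 1 * (e / 2 + K / n%:R * (x * (1 - x))).
  rewrite -Bq; apply: bernstein_le => // k /fK.
  by rewrite ler_norml => /andP[_]; rewrite !mul1r; lra.
by rewrite distrC ler_norml; apply/andP; split; lra.
Qed.

(** The polynomial is evaluated at x - a, because the moments used later are
    taken about the left end point. *)
Lemma weierstrass f a b e : a < b -> continuous f -> 0 < e ->
  exists p : {poly R}, forall x, a <= x <= b -> `|f x - p.[x - a]| <= e.
Proof.
move=> ab cf e0; have ba0 : 0 < b - a by rewrite subr_gt0.
have [|p pE] := @weierstrass01 (fun x => f (a + (b - a) * x)) e _ e0.
  move=> x; apply: continuous_comp; last exact: cf.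
  apply: continuousD; first exact: cvg_cst.
  by apply: continuousM; [exact: cvg_cst|exact: cvg_id].
exists (p \Po ((b - a)^-1 *: 'X)) => x /andP[ax xb].
rewrite horner_comp !hornerE.
have x01 : 0 <= (b - a)^-1 * (x - a) <= 1.
  rewrite mulr_ge0 ?invr_ge0 ?subr_ge0 ?(ltW ab)//=.
  by rewrite mulrC ler_pdivrMr// mul1r lerB.
have := pE _ x01; rewrite mulrA divff ?gt_eqF// mul1r.
by rewrite (addrC a) subrK.
Qed.
End weierstrass.

(** * The method of moments on a fixed segment *)

Section moments.
Context (R : realType).
Implicit Types (mu nu : {measure set (measurableTypeR R) -> \bar R}).
Implicit Types (f : R -> R) (p : {poly R}) (m : nat -> R).

(** Moments are taken with |x - a| so that the integrands are nonnegative on the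
    whole line; on the segment they coincide with the moments about a. *)
Lemma integral_poly_approx nu a b m f p e : a <= b -> nu (~` `[a, b]) = 0%E ->
  (forall k, \int[nu]_x (`|x - a| ^+ k)%:E = (m k)%:E)%E ->
  continuous f -> bounded_fun f ->
  (forall x, a <= x <= b -> `|f x - p.[x - a]| <= e) ->
  exists2 c, (\int[nu]_x (f x)%:E = c%:E)%E &
    `|c - \sum_(k < size p) p`_k * m k| <= e * m 0%N.
Proof.
move=> ab nu0 mE cf bf fp.
have mT : nu setT = (m 0%N)%:E.
  by rewrite -mE; under eq_integral do rewrite expr0; rewrite integral_cst// mul1e.
have ifin : nu.-integrable setT (EFin \o f).
  apply: measurable_bounded_integrable => //.
  - by rewrite [X in (X < _)%E]mT ltry.
  - exact: continuous_measurable_fun.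
have ik k : nu.-integrable setT (fun x => (`|x - a| ^+ k)%:E).
  apply/integrableP; split.
    apply/measurable_EFinP; apply: measurable_funX; apply: measurableT_comp => //.
    exact: measurable_funB.
  under eq_integral do rewrite abse_EFin ger0_norm ?exprn_ge0//.
  by rewrite mE ltry.
pose h x := p.[`|x - a|].
have hE x : (h x)%:E = (\sum_(k < size p) (p`_k)%:E * (`|x - a| ^+ k)%:E)%E.
  by rewrite /h horner_coef -sumEFin.
have ih : nu.-integrable setT (fun x => (h x)%:E).
  under eq_fun do rewrite hE.
  by apply: integrable_sum => // k _; exact: integrableZl.
have intE : (\int[nu]_x (h x)%:E = (\sum_(k < size p) p`_k * m k)%:E)%E.
  under eq_integral do rewrite hE.
  rewrite integral_sum//; last by move=> k; exact: integrableZl.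
  by rewrite -sumEFin; apply: eq_bigr => k _; rewrite integralZl// mE.
have ffin : (\int[nu]_x (f x)%:E)%E \is a fin_num.
  exact: (integrable_fin_num _ ifin).
exists (fine (\int[nu]_x (f x)%:E)%E); first by rewrite fineK.
rewrite -lee_fin -abse_EFin EFinB fineK// -intE -integralB_EFin//.
apply: (le_trans (le_abse_integral _ _ _)) => //.
  by apply: emeasurable_funB; [exact: measurable_int ifin|exact: measurable_int ih].
rewrite EFinM -mT -[leRHS](integral_cst nu measurableT).
have fh x : `[a, b]%classic x -> `|f x - h x| <= e.
  rewrite /= in_itv/= => xab; have /andP[ax _] := xab.
  have xa : `|x - a| = x - a by rewrite ger0_norm// subr_ge0.
  by rewrite /h xa fp.
have e0 : 0 <= e by rewrite (le_trans _ (fp a _))// lexx.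
apply: ae_ge0_le_integral => //.
- apply: measurableT_comp => //.
  by apply: emeasurable_funB; [exact: measurable_int ifin|exact: measurable_int ih].
exists (~` `[a, b]); split => //; first exact: measurableC.
move=> x /= H xab; apply: H => _.
by rewrite /= lee_fin; exact: fh.
Qed.

(** Uniform approximation of f by a polynomial costs at most e1 times the total
    mass, on both sides, uniformly in i. *)
Lemma moments_weak_cvg (I : Type) (F : set_system I) {FF : Filter F}
    (mu : I -> {measure set (measurableTypeR R) -> \bar R}) nu (a b : R)
    (m : I -> nat -> R) (l : nat -> R) : a < b ->
  (\forall i \near F, mu i (~` `[a, b]) = 0%E /\
     forall k, (\int[mu i]_x (`|x - a| ^+ k)%:E = (m i k)%:E)%E) ->
  nu (~` `[a, b]) = 0%E ->
  (forall k, \int[nu]_x (`|x - a| ^+ k)%:E = (l k)%:E)%E ->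
  (forall k, m i k @[i --> F] --> l k) ->
  weak_cvg F mu nu.
Proof.
move=> ab muE nu0 nuE ml f cf bf.
have l0 : 0 <= l 0%N.
  by rewrite -lee_fin -nuE; apply: integral_ge0 => x _; rewrite lee_fin exprn_ge0.
have [p0 fp0] := weierstrass ab cf (@ltr01 R).
have [c cE _] := integral_poly_approx (ltW ab) nu0 nuE cf bf fp0.
rewrite cE; apply/fine_cvgP; split.
  near=> i.
  have [mui0 muiE] : mu i (~` `[a, b]) = 0%E /\
    forall k, (\int[mu i]_x (`|x - a| ^+ k)%:E = (m i k)%:E)%E by near: i.
  have [d -> _] := integral_poly_approx (ltW ab) mui0 muiE cf bf fp0.
  by rewrite fin_numE.
apply/cvgrPdist_le => /= e e0.
pose e1 := e / (2 * l 0%N + 2).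
have e10 : 0 < e1 by rewrite divr_gt0// ltr_wpDl// mulr_ge0.
have [p fp] := weierstrass ab cf e10.
have pm : \sum_(k < size p) p`_k * m i k @[i --> F] --> \sum_(k < size p) p`_k * l k.
  apply: cvg_big => [|k _]; first exact: add_continuous.
  by apply: cvgM; [exact: cvg_cst|exact: ml].
have [c' ] := integral_poly_approx (ltW ab) nu0 nuE cf bf fp.
rewrite cE => -[<-] cp.
near=> i.
have [mui0 muiE] : mu i (~` `[a, b]) = 0%E /\
  forall k, (\int[mu i]_x (`|x - a| ^+ k)%:E = (m i k)%:E)%E by near: i.
have [d -> dp] := integral_poly_approx (ltW ab) mui0 muiE cf bf fp.
have mi : `|l 0%N - m i 0%N| < 1.
  by near: i; move/cvgrPdist_lt : (ml 0%N); apply.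
have pi : `|\sum_(k < size p) p`_k * l k - \sum_(k < size p) p`_k * m i k| < e1.
  by near: i; move/cvgrPdist_lt : pm; apply.
have -> : e = e1 * l 0%N + e1 * (l 0%N + 1) + e1.
  by rewrite /e1; field; rewrite gt_eqF// ltr_wpDl// mulr_ge0.
move: cp dp pi; set A := \sum_(k < _) _; set B := \sum_(k < _) _ => cp dp pi /=.
have dp' : `|d - B| <= e1 * (l 0%N + 1).
  rewrite (le_trans dp)// ler_pM2l//.
  by move: mi; rewrite ltr_norml => /andP[]; lra.
have := ler_distD A c d; have := ler_distD B A d; rewrite (distrC B d).
lra.
Unshelve. all: by end_near. Qed.
End moments.

(** * Projection-valued measures *)

Section inner_theory.
Local Open Scope complex_scope.
Context (R : realType) (H : hilbertType R).
Implicit Types x y z : H.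

Lemma innerDl x y z : inner (x + y) z = inner x z + inner y z.
Proof. by rewrite linearDl. Qed.

Lemma innerDr x y z : inner x (y + z) = inner x y + inner x z.
Proof. by rewrite linearDr. Qed.

Lemma innerBl x y z : inner (x - y) z = inner x z - inner y z.
Proof. by rewrite linearBl. Qed.

Lemma innerBr x y z : inner x (y - z) = inner x y - inner x z.
Proof. by rewrite linearBr. Qed.

Lemma innerZl a x y : inner (a *: x) y = a * inner x y.
Proof. by rewrite linearZl. Qed.

Lemma innerZr a x y : inner x (a *: y) = a^* * inner x y.
Proof. by rewrite linearZr. Qed.

Lemma innerC x y : inner y x = (inner x y)^*.
Proof. by rewrite hermC /= expr0 mul1r. Qed.

End inner_theory.

Section pvm_theory.
Local Open Scope complex_scope.
Context (R : realType) (H : hilbertType R) (E : pvm H).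
Implicit Types (A B : set (measurableTypeR R)) (x y : H).

Lemma pvm_setU A B x : measurable A -> measurable B -> A `&` B = set0 ->
  E (A `|` B) x = E A x + E B x.
Proof.
move=> mA mB AB.
have mF n : measurable (bigcup2 A B n) by case: n => [//|[//|n]] /=.
have tF : trivIset setT (bigcup2 A B) by rewrite -trivIset_bigcup2.
have := @pvm_sigma_additive _ _ E _ x mF tF.
rewrite bigcup2E => EAB.
apply: (cvg_unique (@norm_hausdorff _ H) EAB).
apply: cvg_near_cst; exists 2%N => // n /= n2.
rewrite -(subnKC n2) addnC addn2 !big_nat_recl//= big1_seq ?addr0// => i _.
by rewrite /bigcup2 /= pvm_set0.
Qed.

(** A sum of two projections that is again a projection has orthogonal
    terms. *)
Lemma pvm_disjoint A B x : measurable A -> measurable B -> A `&` B = set0 ->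
  E A (E B x) = 0.
Proof.
move=> mA mB AB; set y := E B x; set u := E A y.
have yB : E B y = y by rewrite pvm_idem.
have uA : E A u = u by rewrite pvm_idem.
have uN : u = - E B u.
  have : E (A `|` B) (E (A `|` B) y) = E (A `|` B) y by rewrite pvm_idem.
  rewrite !pvm_setU// yB -/u linearD /= uA -/u linearD /= yB addrA => /addIr.
  by rewrite -addrA => /eqP; rewrite -subr_eq0 addrAC subrr add0r addr_eq0 => /eqP.
have : E B u = - E B u by rewrite {1}uN linearN /= pvm_idem.
move/eqP; rewrite -addr_eq0 -mulr2n -scaler_nat scaler_eq0 pnatr_eq0 /=.
by move=> /eqP Bu; rewrite uN Bu oppr0.
Qed.

Lemma pvm_setI A B x : measurable A -> measurable B ->
  E B (E A x) = E (A `&` B) x.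
Proof.
move=> mA mB.
have mAB : measurable (A `&` B) by exact: measurableI.
have mAD : measurable (A `\` B) by exact: measurableD.
rewrite -{1}(setUIDK A B) pvm_setU//; last first.
  by apply/seteqP; split=> t //=; tauto.
rewrite linearD /= (@pvm_disjoint B (A `\` B))// ?addr0; last first.
  by apply/seteqP; split=> t //=; tauto.
have mBD : measurable (B `\` A) by exact: measurableD.
rewrite -{1}(setUIDK B A) pvm_setU// 1?(setIC B A)//; last first.
  by apply/seteqP; split=> t //=; tauto.
rewrite (@pvm_disjoint (B `\` A))// ?addr0 ?pvm_idem//.
by apply/seteqP; split=> t //=; tauto.
Qed.

Lemma pvm_setC A x : measurable A -> E A x + E (~` A) x = x.
Proof.
move=> mA; rewrite -pvm_setU ?setICr//; last exact: measurableC.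
by rewrite setUv pvm_setT.
Qed.

Lemma pvm_setCr A x : measurable A -> E A (E (~` A) x) = 0.
Proof. by move=> mA; rewrite pvm_disjoint ?setICr//; exact: measurableC. Qed.

Lemma pvm_setCl A x : measurable A -> E (~` A) (E A x) = 0.
Proof. by move=> mA; rewrite pvm_disjoint ?setICl//; exact: measurableC. Qed.

Lemma pvm_distT x : pvm_dist E x setT = (complex.Re (inner x x))%:E.
Proof. by rewrite /pvm_dist pvm_setT. Qed.

(** Projecting the vector restricts its spectral distribution. *)
Lemma pvm_dist_proj A B x : measurable A -> measurable B ->
  pvm_dist E (E A x) B = pvm_dist E x (A `&` B).
Proof.
move=> mA mB; rewrite /pvm_dist pvm_setI// pvm_selfadj pvm_setI//.
  by rewrite setIAC setIid.
exact: measurableI.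
Qed.

Lemma integral_pvm_dist_proj A x (g : R -> R) : measurable A ->
  measurable_fun setT g ->
  (\int[pvm_dist E (E A x)]_t (g t)%:E = \int[pvm_dist E x]_(t in A) (g t)%:E)%E.
Proof.
move=> mA mg.
have mCA : measurable (~` A) by exact: measurableC.
rewrite -[X in (\int[_]_(_ in X) _)%E](setUv A) integral_setU//; last 2 first.
- by apply/measurable_funTS/measurable_EFinP.
- by rewrite disj_set2E setICr.
rewrite [X in (_ + X)%E](_ : _ = 0%E) ?adde0; last first.
  rewrite null_set_integral//.
  - exact/measurable_funTS/measurable_EFinP.
  - by apply: etrans (pvm_dist_proj x mA mCA) _; rewrite setICr measure0.
apply: eq_measure_integral => B mB BA.
by apply: etrans (pvm_dist_proj x mA mB) _; rewrite setIC setIidl.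
Qed.

End pvm_theory.

(** * Moments of a spectral distribution *)

Lemma iter_linearD (R : pzRingType) (V : lmodType R) (f : {linear V -> V}) k :
  {morph iter k f : x y / x + y}.
Proof. by elim: k => // k IHk x y; rewrite !iterS IHk linearD. Qed.

Lemma iter_linearN (R : pzRingType) (V : lmodType R) (f : {linear V -> V}) k :
  {morph iter k f : x / - x}.
Proof. by elim: k => // k IHk x; rewrite !iterS IHk linearN. Qed.

(** S is a nonnegative operator related to E through its quadratic form only;
    [g] plays the role of its symbol, so that formally S = g(E). *)
Section functional_calculus.
Local Open Scope complex_scope.
Context (R : realType) (H : hilbertType R) (E : pvm H).
Variables (S : {linear H -> H}) (g : R -> R).
Hypothesis mg : measurable_fun setT g.
Hypothesis ig : forall x, (pvm_dist E x).-integrable setT (EFin \o g).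
Hypothesis gE : forall x, inner (S x) x = (\int[pvm_dist E x]_t g t)%:C.
Hypothesis S_ge0 : forall x, 0 <= complex.Re (inner (S x) x).
Implicit Types (A B : set (measurableTypeR R)) (x y : H).

(** A quadratic form with real values has a symmetric operator. *)
Lemma spectral_symmetric x y : inner (S x) y = inner x (S y).
Proof.
have im z : complex.Im (inner (S z) z) = 0 by rewrite gE.
have := im (x + y); have := im (x + 'i *: y).
rewrite ![S (_ + _)]linearD [S (_ *: _)]linearZ /= !innerDl !innerDr !innerZl !innerZr.
have := im x; have := im y; rewrite (innerC (S y) x).
case: (inner (S x) x) => a1 b1; case: (inner (S y) y) => a2 b2 /= -> ->.
case: (inner (S x) y) => a3 b3; case: (inner (S y) x) => a4 b4 /=.
by move=> h1 h2; congr (_ +i* _); lra.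
Qed.

Let integral_proj A x : measurable A ->
  ((\int[pvm_dist E (E A x)]_t g t)%:E = \int[pvm_dist E x]_(t in A) (g t)%:E)%E.
Proof.
move=> mA; rewrite -integral_pvm_dist_proj// fineK//.
by apply: integrable_fin_num => //; exact: ig.
Qed.

(* The measure of x is the sum of those of its two projections, hence the
   quadratic form has no cross terms. *)
Let quad_split A x : measurable A -> inner (S x) x =
  inner (S (E A x)) (E A x) + inner (S (E (~` A) x)) (E (~` A) x).
Proof.
move=> mA; rewrite !gE -raddfD /=; congr (_%:C).
have mCA : measurable (~` A) by exact: measurableC.
apply: EFin_inj; rewrite EFinD.
rewrite (integral_proj x mA) (integral_proj x mCA).
rewrite -integral_setU ?setUv//.
- by rewrite /Rintegral fineK//; apply: integrable_fin_num => //; exact: ig.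
- exact/measurable_EFinP.
- by rewrite disj_set2E setICr.
Qed.

(** S preserves the range of each E(A). The vanishing of the symmetrized cross
    terms for v and for 'i v separates the two of them. *)
Lemma spectral_cross A x y : measurable A ->
  inner (S (E A x)) (E (~` A) y) = 0.
Proof.
move=> mA; set u := E A x; set v := E (~` A) y.
have mCA : measurable (~` A) by exact: measurableC.
have split (a : R[i]) : inner (S (u + a *: v)) (u + a *: v) =
    inner (S u) u + inner (S (a *: v)) (a *: v).
  rewrite (quad_split _ mA) [E A (_ + _)]linearD [E (~` A) (_ + _)]linearD.
  rewrite [E A (_ *: _)]linearZ [E (~` A) (_ *: _)]linearZ /u /v /=.
  by rewrite !pvm_idem pvm_setCr// pvm_setCl// scaler0 addr0 add0r.
have := split 1; have := split 'i.
rewrite ![S (_ + _)]linearD ![S (_ *: _)]linearZ /= !innerDl !innerDr !innerZl !innerZr !mul1r.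
case: (inner (S u) u) => a1 b1; case: (inner (S v) v) => a2 b2 /=.
case: (inner (S u) v) => a3 b3; case: (inner (S v) u) => a4 b4 /=.
move=> [h1 h2] [h3 h4].
by apply/eqP; rewrite eq_complex /=; apply/andP; split; apply/eqP; lra.
Qed.

(** With A = {g < 0}, the integral of g over A is <S E(A) x, E(A) x> >= 0. *)
Lemma spectral_dist_lt0 x : pvm_dist E x [set t | g t < 0] = 0%E.
Proof.
set A := [set t | g t < 0].
have mA : measurable A.
  rewrite (_ : A = g @^-1` `]-oo, 0[); last first.
    by apply/seteqP; split => t /=; rewrite in_itv.
  by rewrite -[X in measurable X]setTI; exact: mg.
have gA : (\int[pvm_dist E x]_(t in A) `|(g t)%:E| = 0)%E.
  apply/eqP; rewrite eq_le integral_ge0// andbT.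
  under eq_integral => t.
    rewrite inE /A /= => gt; rewrite ltr0_norm// -mulN1r EFinM.
    over.
  rewrite integralZl//; last by apply: integrableS (ig x).
  rewrite -integral_proj// mulN1e -EFinN lee_fin oppr_le0.
  by have := S_ge0 (E A x); rewrite gE.
have : ae_eq (pvm_dist E x) A (EFin \o g) (cst 0%E).
  by apply/ae_eq_integral_abs => //; apply/measurable_funTS/measurable_EFinP.
move=> [N [mN N0 AN]].
apply: (@subset_measure0 _ _ _ (pvm_dist E x) _ N mA mN) => // t At; apply: AN => /= g0.
by have := At; rewrite /A/= (EFin_inj (g0 At)) ltxx.
Qed.

Let integral_absg A x : measurable A ->
  (\int[pvm_dist E x]_(t in A) `|(g t)%:E| = \int[pvm_dist E x]_(t in A) (g t)%:E)%E.
Proof.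
move=> mA; apply: ae_eq_integral => //.
- exact/measurableT_comp/measurable_funTS/measurable_EFinP.
- exact/measurable_funTS/measurable_EFinP.
exists [set t | g t < 0]; split.
- rewrite (_ : [set _ | _] = g @^-1` `]-oo, 0[); last first.
    by apply/seteqP; split => t /=; rewrite in_itv.
  by rewrite -[X in measurable X]setTI; exact: mg.
- exact: spectral_dist_lt0.
move=> t /= H1; rewrite ltNge; apply/negP => g0; apply: H1 => _.
by rewrite /= ger0_norm.
Qed.

(** Polarization of <., E(A) .> at x and S x: the cross term <S x, E(A) x> is the
    integral of g over A. *)
Lemma spectral_dist_density A x : measurable A ->
  (pvm_dist E (x + S x)%R A = pvm_dist E (x - S x)%R A +
    \int[pvm_dist E x]_(t in A) (4 * `|g t|)%:E)%E.
Proof.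
move=> mA; under eq_integral do rewrite EFinM.
rewrite ge0_integralZl//; last first.
  exact/measurable_EFinP/measurableT_comp/measurable_funTS.
under eq_integral do rewrite -abse_EFin.
rewrite integral_absg// -integral_proj// -EFinM -EFinD; congr EFin.
have : inner (S (E A x)) (E A x) = inner (S x) (E A x).
  rewrite -{3}(pvm_setC E x mA) [S (_ + _)]linearD innerDl /=.
  suff -> : inner (S (E (~` A) x)) (E A x) = 0 by rewrite addr0.
  by rewrite spectral_symmetric innerC spectral_cross// conjc0.
rewrite gE => /(congr1 (@complex.Re R)) /= ->.
rewrite [E A (x + _)]linearD [E A (x - _)]linearB /=.
rewrite !innerBl !innerBr !innerDl !innerDr -!(pvm_selfadj E A x).
rewrite (innerC (S x) (E A x)).
case: (inner (E A x) x) => a1 b1; case: (inner (S x) (E A x)) => a2 b2.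
case: (inner (S x) (E A (S x))) => a3 b3 /=; lra.
Qed.

(** Step: apply the moment k to x + S x and x - S x, whose distributions differ by
    the density 4 |g|; on the operator side the difference is
    4 Re <S^(k+1) x, x> by symmetry. *)
Lemma spectral_moment (k : nat) x :
  (\int[pvm_dist E x]_t (`|g t| ^+ k)%:E =
   (complex.Re (inner (iter k S x) x))%:E)%E.
Proof.
elim: k x => [|k IHk] x.
  under eq_integral do rewrite expr0.
  rewrite integral_cst// mul1e; exact: pvm_distT.
have mgk j : measurable_fun setT (fun t => (`|g t| ^+ j)%:E).
  by apply/measurable_EFinP; apply: measurable_funX; exact: measurableT_comp.
have := @ge0_integral_density _ _ _ (pvm_dist E x) (pvm_dist E (x + S x))
  (pvm_dist E (x - S x)) (fun t => 4 * `|g t|) _ _ _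
  (fun t => (`|g t| ^+ k)%:E) (mgk k) _.
have m4g : measurable_fun setT (fun t => 4 * `|g t|).
  by apply: measurable_funM => //; exact: measurableT_comp.
have g40 t : 0 <= 4 * `|g t| by rewrite mulr_ge0.
have gk0 t : (0 <= (`|g t| ^+ k)%:E)%E by rewrite lee_fin exprn_ge0.
move=> /(_ m4g g40 (fun A => @spectral_dist_density A x) gk0).
rewrite !IHk.
under eq_integral do rewrite -EFinM mulrCA -exprSr EFinM.
rewrite ge0_integralZl//; last exact: (mgk k.+1).
rewrite !iter_linearD iter_linearN !innerBl !innerBr !innerDl !innerDr.
rewrite -!iterSr -![inner (iter k S x) (S x)]spectral_symmetric -iterS.
case: (inner (iter k S x) x) => a1 b1; case: (inner (iter k.+1 S x) x) => a2 b2.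
case: (inner (iter k.+1 S x) (S x)) => a3 b3.
case: (integral _ _ _) => [I| |].
- rewrite -EFinM -EFinD => -[h]; congr EFin; rewrite /=; lra.
- by rewrite gt0_muley.
- by rewrite gt0_muleNy.
Qed.
End functional_calculus.

(** * Integration against the arcsine weight *)

(** Substitution x = r cos t. The integrand is unbounded at both end points, so
    the integral is exhausted by the segments [- r cos t_n, r cos t_n] with t_n
    decreasing to 0; at these end points the primitive
    - Phi (acos (x / r)) takes the values - Phi (pi - t_n) and - Phi (t_n). *)
Section arcsine_substitution.
Context (R : realType) (r : R).
Hypothesis r0 : 0 < r.
Local Notation lambda := (@lebesgue_measure R).

Let subr_sqr_gt0 x : - r < x < r -> 0 < r ^+ 2 - x ^+ 2.
Proof. by move=> /andP[rx xr]; nra. Qed.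

Let divr_itv x : - r < x < r -> -1 < x / r < 1.
Proof. by move=> /andP[rx xr]; rewrite ltr_pdivlMr// ltr_pdivrMr// mulN1r mul1r rx. Qed.

Lemma is_derive_acos_div x : - r < x < r ->
  is_derive x 1 (fun x : R => acos (x / r)) (- (sqrtr (r ^+ 2 - x ^+ 2))^-1).
Proof.
move=> xr; have xr1 := divr_itv xr.
have h1 : is_derive x 1 (fun x : R => x / r) (r^-1).
  rewrite (_ : (fun x => x / r) = r^-1 \*: id); last first.
    by apply/funext => y /=; rewrite /GRing.scale/= mulrC.
  by apply: is_derive_eq; rewrite [_%:A]mulr1.
have acosE := @is_derive1_comp _ (@acos R) (fun x => x / r) x _ _ (is_derive1_acos xr1) h1.
suff -> : sqrtr (r ^+ 2 - x ^+ 2) = sqrtr (1 - (x / r) ^+ 2) * r.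
  by rewrite invfM -mulNr; exact: acosE.
rewrite -{3}(ger0_norm (ltW r0)) -sqrtr_sqr -sqrtrM; last first.
  by have := xr1; set y := x / r => /andP[y1 y2]; nra.
by congr sqrtr; field; rewrite gt_eqF.
Qed.

Variables (phi Phi : R -> R).
Hypotheses (cphi : continuous phi) (phi0 : forall t, 0 <= phi t).
Hypothesis dPhi : forall t : R, is_derive t 1 Phi (phi t).

Let f x := phi (acos (x / r)) / sqrtr (r ^+ 2 - x ^+ 2).

Let f_ge0 x : 0 <= f x.
Proof. by rewrite divr_ge0 ?sqrtr_ge0. Qed.

Let dF x : - r < x < r -> is_derive x 1 (fun x : R => - Phi (acos (x / r))) (f x).
Proof.
move=> xr; have := is_derive1_comp (dPhi _) (is_derive_acos_div xr).
by move/is_deriveN; rewrite mulrN opprK.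
Qed.

Let cf x : - r < x < r -> {for x, continuous f}.
Proof.
move=> xr.
have c1 : {for x, continuous (phi \o (fun x => acos (x / r)))}.
  apply: continuous_comp; last exact: cphi.
  by apply: differentiable_continuous; apply/derivable1_diffP; case: (is_derive_acos_div xr).
have c2 : {for x, continuous (@sqrtr R \o (fun x : R => r ^+ 2 - x ^+ 2))}.
  apply: continuous_comp; last exact: sqrt_continuous.
  by apply: continuousB; [exact: cst_continuous|exact: (@exprn_continuous R 2 x)].
have c3 : {for x, continuous (fun x : R => (sqrtr (r ^+ 2 - x ^+ 2))^-1)}.
  by apply: continuousV c2; rewrite /= gt_eqF ?sqrtr_gt0 ?subr_sqr_gt0.
exact: continuousM c1 c3.
Qed.

Lemma measurable_acos_weight : measurable_fun `]- r, r[%classic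
  (fun x => phi (acos (x / r)) / sqrtr (r ^+ 2 - x ^+ 2)).
Proof.
apply: open_continuous_measurable_fun; first exact: interval_open.
by move=> x; rewrite inE /= in_itv/= => xr; exact: cf.
Qed.

Let t (n : nat) : R := pi / 2 * (n.+2%:R)^-1.

Let t_itv n : 0 < t n < pi / 2.
Proof.
have p0 : 0 < pi / 2 :> R by rewrite divr_gt0 ?pi_gt0.
by rewrite mulr_gt0 ?invr_gt0//= gtr_pMr// invf_lt1// ltr1n.
Qed.

Let cos_t_itv n : 0 < cos (t n) < 1.
Proof.
have /andP[t0 tp] := t_itv n; have p0 := pi_gt0 R.
rewrite cos_gt0_pihalf/=; last by apply/andP; split; lra.
by rewrite -cos0 ltr_cos// in_itv/=; apply/andP; split; lra.
Qed.

Let b n : R := r * cos (t n).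

Let b_itv n : 0 < b n < r.
Proof. by have /andP[c0 c1] := cos_t_itv n; rewrite mulr_gt0//= gtr_pMr. Qed.

Let I n : set R := `[- b n, b n]%classic.

Let integral_f_b n : (\int[lambda]_(x in I n) (f x)%:E =
  (Phi (pi - t n) - Phi (t n))%:E)%E.
Proof.
have /andP[t0 tp] := t_itv n; have p0 := pi_gt0 R; have /andP[b0 br] := b_itv n.
have itv x : - b n <= x <= b n -> - r < x < r by move=> /andP[? ?]; apply/andP; split; lra.
have cF x : - b n <= x <= b n -> {for x, continuous (fun x : R => - Phi (acos (x / r)))}.
  by move=> /itv xr; apply: differentiable_continuous; apply/derivable1_diffP; case: (dF xr).
have bn : - b n < b n by lra.
rewrite (@continuous_FTC2 _ f (fun x : R => - Phi (acos (x / r))))//; first last.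
- by move=> x; rewrite in_itv/= => /andP[? ?]; rewrite derive1E;
    case: (@dF x) => //; apply: itv; apply/andP; split; lra.
- split.
  + by move=> x; rewrite in_itv/= => /andP[? ?];
      case: (@dF x) => //; apply: itv; apply/andP; split; lra.
  + by apply: cvg_at_right_filter; apply: cF; rewrite lexx ltW.
  + by apply: cvg_at_left_filter; apply: cF; rewrite lexx ltW.
- apply: continuous_in_subspaceT => x; rewrite inE /= in_itv/= => xb.
  exact/cf/itv.
have bE : b n / r = cos (t n) by rewrite /b mulrAC divff ?mul1r// gt_eqF.
have tK : acos (cos (t n)) = t n by rewrite cosK// in_itv/= ltW//=; lra.
rewrite mulNr bE -EFinB opprK addrC acosN ?tK//.
by have /andP[c0 c1] := cos_t_itv n; apply/andP; split; lra.
Qed.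

Let t_cvg0 : t n @[n --> \oo] --> 0.
Proof.
rewrite -(mulr0 (pi / 2)); apply: cvgM; first exact: cvg_cst.
have := @cvg_harmonic R; rewrite -cvg_shiftS => /=; exact.
Qed.

Let cPhi : continuous Phi.
Proof.
by move=> x; apply: differentiable_continuous; apply/derivable1_diffP; case: (dPhi x).
Qed.

Let b_cvg : b n @[n --> \oo] --> r.
Proof.
have c1 : cos (t n) @[n --> \oo] --> (1 : R).
  by rewrite -(cos0 R); apply: continuous_cvg t_cvg0; exact: continuous_cos.
by rewrite -[X in _ --> X]mulr1; apply: cvgM c1; exact: cvg_cst.
Qed.

Let bigcup_I : \bigcup_n I n = `]- r, r[%classic.
Proof.
apply/seteqP; split => x /=.
  move=> [n _]; rewrite /I /= !in_itv/= => /andP[? ?].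
  by have /andP[? ?] := b_itv n; apply/andP; split; lra.
rewrite in_itv/= => /andP[rx xr].
have xr0 : `|x| < r by rewrite ltr_norml rx.
have [n _ /(_ n (leqnn n))] := cvgr_gt _ b_cvg _ xr0.
move=> xb; exists n => //; rewrite /I/= in_itv/=.
by move: (ltW xb); rewrite ler_norml.
Qed.

Lemma integral_acos_substitution :
  (\int[lambda]_(x in `](- r)%R, r[) (phi (acos (x / r)) / sqrtr (r ^+ 2 - x ^+ 2))%:E =
  (Phi pi - Phi 0)%:E)%E.
Proof.
have ndI : nondecreasing_seq I.
  apply/nondecreasing_seqP => n; apply/subsetPset => x; rewrite /I/= !in_itv/=.
  suff : b n <= b n.+1 by move=> ? /andP[? ?]; apply/andP; split; lra.
  have /andP[t0 tp] := t_itv n; have /andP[t0' tp'] := t_itv n.+1; have p0 := pi_gt0 R.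
  rewrite /b ler_pM2l// leNgt ltr_cos ?in_itv/=; try by apply/andP; split; lra.
  rewrite -leNgt /t ler_pM2l ?divr_gt0// lef_pV2 ?posrE// ler_nat; exact: leqnSn.
have mf n : measurable_fun (I n) (fun x => (f x)%:E).
  apply/measurable_EFinP; apply: subspace_continuous_measurable_fun; first exact: measurable_itv.
  apply: continuous_in_subspaceT => x; rewrite inE /I /= in_itv/= => /andP[? ?].
  by have /andP[? ?] := b_itv n; apply: cf; apply/andP; split; lra.
have : (\int[lambda]_(x in I n) (f x)%:E @[n --> \oo] -->
        \int[lambda]_(x in \bigcup_n I n) (f x)%:E)%E.
  apply: ge0_nondecreasing_set_cvg_integral => //.
  - by move=> n; exact: measurable_itv.
  - by move=> n x _; exact: f_ge0.
rewrite bigcup_I; under eq_fun do rewrite integral_f_b.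
move=> /(cvg_lim (@ereal_hausdorff R)) <-.
apply/cvg_lim => //; apply: cvg_EFin; first exact: nearW.
apply: cvgB; last by apply: continuous_cvg t_cvg0; exact: cPhi.
apply: continuous_cvg; first exact: cPhi.
rewrite -[X in _ --> X]subr0; apply: cvgB => //; exact: cvg_cst.
Qed.
End arcsine_substitution.

(** * Integration against the Konno distribution *)

Section konno_integral.
Context (R : realType) (r : R).
Hypothesis r01 : 0 < r < 1.
Let s := sqrtr (1 - r ^+ 2).
Let D : set (measurableTypeR R) := `]- r, r[%classic.

Let r0 : 0 < r. Proof. by case/andP: r01. Qed.
Let r2 : 0 < 1 - r ^+ 2. Proof. by case/andP: r01 => ? ?; nra. Qed.
Let s0 : 0 < s. Proof. by rewrite sqrtr_gt0. Qed.
Let s2 : s ^+ 2 = 1 - r ^+ 2. Proof. by rewrite sqr_sqrtr// ltW. Qed.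
Let sqr_itv x : - r < x < r -> 0 < 1 - x ^+ 2.
Proof. by case/andP: r01 => ? ? /andP[? ?]; nra. Qed.
Let mD : measurable D. Proof. exact: measurable_itv. Qed.

Lemma ge0_integral_konno (f : R -> R) : measurable_fun setT f -> (forall x, 0 <= f x) ->
  (\int[konno r]_x (f x)%:E = \int[lebesgue_measure]_(x in D) (f x * konno_pdf r x)%:E)%E.
Proof.
move=> mf f0.
rewrite (@ge0_integral_density _ _ _ lebesgue_measure _ mzero (konno_pdf r))//.
- rewrite integral_measure_zero add0e [RHS]integral_mkcond.
  apply: eq_integral => x _; rewrite patchE; case: ifPn => //= xD.
  by rewrite /konno_pdf indicE (negbTE xD) !mulr0 mule0.
- exact: measurable_konno_pdf.
- exact: konno_pdf_ge0.
- by move=> A mA; rewrite add0e.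
- exact/measurable_EFinP.
Qed.

Lemma konno_setC : konno r (~` D) = 0%E.
Proof.
rewrite /konno integral0_eq// => x xD; rewrite /konno_pdf indicE memNset//.
by rewrite !mulr0.
Qed.

Lemma integral_konno_itv (f : R -> \bar R) : measurable_fun setT f ->
  (\int[konno r]_x f x = \int[konno r]_(x in D) f x)%E.
Proof.
move=> mf; have mCD : measurable (~` D) by exact: measurableC.
rewrite -[X in (\int[_]_(_ in X) _)%E](setUv D) integral_setU//; last 2 first.
- exact: measurable_funTS.
- by rewrite disj_set2E setICr.
rewrite [X in (_ + X)%E](_ : _ = 0%E) ?adde0// null_set_integral//.
- exact: measurable_funTS.
- exact: konno_setC.
Qed.

(** The factor 1 - x^2 cancels the denominator of the density and leaves the
    arcsine weight. *)
Lemma integral_konno_weight (phi Phi : R -> R) (f : R -> R) :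
  continuous phi -> (forall t, 0 <= phi t) -> (forall t : R, is_derive t 1 Phi (phi t)) ->
  continuous f -> (forall x, - r < x < r -> f x = phi (acos (x / r)) * (1 - x ^+ 2)) ->
  (\int[konno r]_(x in D) (f x)%:E = (s / pi * (Phi pi - Phi 0))%:E)%E.
Proof.
move=> cphi phi0 dPhi cf fE.
transitivity (\int[konno r]_x (`|f x|)%:E)%E.
  rewrite integral_konno_itv; last first.
    by apply/measurable_EFinP/measurableT_comp => //; exact: continuous_measurable_fun.
  apply: eq_integral => x; rewrite inE /D/= in_itv/= => xr.
  by rewrite ger0_norm// fE// mulr_ge0// ltW// sqr_itv.
rewrite ge0_integral_konno//; last first.
  by apply: measurableT_comp => //; exact: continuous_measurable_fun.
rewrite EFinM -(integral_acos_substitution r0 cphi phi0 dPhi) -ge0_integralZl//.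
- apply: eq_integral => x; rewrite inE /D/= in_itv/= => xr.
  have x1 := sqr_itv xr.
  rewrite fE// ger0_norm ?mulr_ge0 ?(ltW x1)// /konno_pdf indicE mem_set/= ?in_itv//.
  rewrite -EFinM mulr1; congr EFin; rewrite -/s !invfM.
  have pi0 : pi != 0 :> R by rewrite gt_eqF ?pi_gt0.
  move: pi0 (x1); set w := (sqrtr _)^-1; move: (pi) => p p0 x10.
  by field; rewrite p0 gt_eqF.
- apply/measurable_EFinP. exact: (measurable_acos_weight r0 cphi).
- by move=> x _; rewrite lee_fin divr_ge0 ?sqrtr_ge0.
- by rewrite lee_fin divr_ge0 ?pi_ge0 ?ltW.
Qed.

(** Comparison with the weight (1 - x^2) / (1 - r^2), which is at least 1 on the
    support and has a finite integral. *)
Lemma konno_fin : (konno r D < +oo)%E.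
Proof.
have cf : continuous (fun x : R => (1 - x ^+ 2) / (1 - r ^+ 2)).
  move=> x; apply: cvgM; last exact: cvg_cst.
  by apply: cvgB; [exact: cvg_cst|exact: exprn_continuous].
have dc t : is_derive (t : R) 1 (fun t : R => (1 - r ^+ 2)^-1 * t) (1 - r ^+ 2)^-1.
  by apply: is_derive_eq; rewrite [_%:A]mulr1.
have int : (\int[konno r]_(x in D) ((1 - x ^+ 2) / (1 - r ^+ 2))%:E < +oo)%E.
  rewrite (@integral_konno_weight (fun _ => (1 - r ^+ 2)^-1) _ _ _ _ dc cf) ?ltry//.
  - by move=> x; exact: cvg_cst.
  - by move=> _; rewrite invr_ge0 ltW.
  - by move=> x _; rewrite mulrC.
have <- : (\int[konno r]_(x in D) (cst 1%E x) = konno r D)%E.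
  by rewrite integral_cst// mul1e.
apply: le_lt_trans int; apply: ge0_le_integral => //.
- apply: measurable_funTS; apply/measurable_EFinP; exact: (continuous_measurable_fun cf).
- move=> x; rewrite /D /= in_itv/= => xr; rewrite lee_fin ler_pdivlMr// mul1r.
  by case/andP: xr => ? ?; nra.
Qed.

Definition konno_mean (f : R -> R) : R := \int[konno r]_(x in D) f x.

Lemma integrable_konno (f : R -> R) : continuous f -> (konno r).-integrable D (EFin \o f).
Proof.
move=> cf; apply: (@measurable_bounded_integrable _ _ _ (konno r)) => //.
- exact: konno_fin.
- by apply: measurable_funTS; exact: continuous_measurable_fun.
have /compact_bounded[M [Mr fM]] :=
  continuous_compact (continuous_subspaceT cf) (@segment_compact R (- r) r).
exists M; split => // N MN x xD; apply: (fM _ MN); exists x => //=.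
by move: xD; rewrite /D /= !in_itv/= => /andP[? ?]; apply/andP; split; exact: ltW.
Qed.

Lemma konno_meanD (f g : R -> R) : continuous f -> continuous g ->
  konno_mean (f \+ g) = konno_mean f + konno_mean g.
Proof.
move=> cf cg; have := integrable_konno cf; have := integrable_konno cg => ig if_.
by rewrite /konno_mean RintegralD.
Qed.

Lemma konno_meanZ c (f : R -> R) : continuous f ->
  konno_mean (fun x => c * f x) = c * konno_mean f.
Proof. by move=> cf; rewrite /konno_mean RintegralZl//; exact: integrable_konno. Qed.

Lemma eq_konno_mean (f g : R -> R) :
  (forall x, - r < x < r -> f x = g x) -> konno_mean f = konno_mean g.
Proof.
move=> fg; rewrite /konno_mean; congr fine; apply: eq_integral => x.
by rewrite inE /D /= in_itv/= => /fg ->.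
Qed.

Lemma konno_mean_norm (f : R -> R) : continuous f ->
  (forall x, - r < x < r -> `|f x| <= 1) ->
  `|konno_mean f| <= konno_mean (cst 1).
Proof.
move=> cf f1; apply: (le_trans (le_normr_Rintegral _ _)) => //.
  exact: integrable_konno.
apply: le_Rintegral.
- exact: mD.
- by apply: integrable_konno => x; apply: cvg_norm; exact: cf.
- by apply: integrable_konno => x; exact: cvg_cst.
- by move=> x; rewrite /D/= in_itv; exact: f1.
Qed.
End konno_integral.

(** * Orthogonal polynomials of the Konno distribution *)

(** T_n (x / r) with T_n the Chebyshev polynomial of the first kind. *)
Fixpoint chebyshev (R : realType) (r : R) n (x : R) : R :=
  if n is m.+1 then
    if m is k.+1 then 2 * (x / r) * chebyshev r m x - chebyshev r k x else x / r
  else 1.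

(** Monic orthogonal polynomials with zero diagonal Jacobi parameters and
    off-diagonal parameters a 1, a 2, .. *)
Fixpoint monic_ops (R : realType) (a : nat -> R) n (x : R) : R :=
  if n is m.+1 then
    if m is k.+1 then x * monic_ops a m x - a m * monic_ops a k x else x
  else 1.

Lemma sin_natpi (R : realType) n : sin (n%:R * pi) = 0 :> R.
Proof.
elim: n => [|n IHn]; first by rewrite mul0r sin0.
by rewrite -natr1 mulrDl mul1r sinD IHn sinpi mul0r mulr0 addr0.
Qed.

Section konno_ops.
Context (R : realType) (r : R).
Hypothesis r01 : 0 < r < 1.
Let s := sqrtr (1 - r ^+ 2).
Let q := (1 - s) / (1 + s).
Local Notation L := (konno_mean r).
Local Notation T := (chebyshev r).
Local Notation P := (monic_ops (omega r)).

Let r0 : 0 < r. Proof. by case/andP: r01. Qed.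
Let r2 : 0 < 1 - r ^+ 2. Proof. by case/andP: r01 => ? ?; nra. Qed.
Let s0 : 0 < s. Proof. by rewrite sqrtr_gt0. Qed.
Let s2 : s ^+ 2 = 1 - r ^+ 2. Proof. by rewrite sqr_sqrtr// ltW. Qed.
Let r2s : r ^+ 2 = (1 - s) * (1 + s). Proof. have := s2; lra. Qed.
Let s1 : s < 1. Proof. by have := s2; have := r0; have := s0; nra. Qed.
Let q0 : 0 < q. Proof. by rewrite divr_gt0 ?subr_gt0// ltr_wpDr// ltW. Qed.
Let q1 : q < 1. Proof. by rewrite ltr_pdivrMr; have := s0; lra. Qed.

Lemma chebyshevSS n x : T n.+2 x = 2 * (x / r) * T n.+1 x - T n x.
Proof. by []. Qed.

Lemma monic_opsSS a n (x : R) :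
  monic_ops a n.+2 x = x * monic_ops a n.+1 x - a n.+1 * monic_ops a n x.
Proof. by []. Qed.

Lemma nat_ind_two_steps (Q : nat -> Prop) :
  Q 0%N -> Q 1%N -> (forall n, Q n -> Q n.+1 -> Q n.+2) -> forall n, Q n.
Proof.
move=> Q0 Q1 QS n; suff [] : Q n /\ Q n.+1 by [].
by elim: n => [|n [Qn Qn1]]; split => //; exact: QS.
Qed.

Lemma continuous_chebyshev n : continuous (T n).
Proof.
elim/nat_ind_two_steps: n => [x|x|n Tn Tn1 x].
- exact: cvg_cst.
- by apply: cvgM; [exact: cvg_id|exact: cvg_cst].
apply: cvgB; last exact: Tn.
apply: cvgM; last exact: Tn1.
by apply: cvgM; [exact: cvg_cst|apply: cvgM; [exact: cvg_id|exact: cvg_cst]].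
Qed.

Lemma continuous_monic_ops a n : continuous (@monic_ops R a n).
Proof.
elim/nat_ind_two_steps: n => [x|x|n Tn Tn1 x].
- exact: cvg_cst.
- exact: cvg_id.
by apply: cvgB; apply: cvgM; [exact: cvg_id|exact: Tn1|exact: cvg_cst|exact: Tn].
Qed.

Lemma chebyshev_acos n x : - r < x < r -> T n x = cos (n%:R * acos (x / r)).
Proof.
move=> xr; have xK : cos (acos (x / r)) = x / r.
  apply: acosK; rewrite in_itv/= ler_pdivlMr// ler_pdivrMr// mulN1r mul1r.
  by case/andP: xr => *; apply/andP; split; apply: ltW.
elim/nat_ind_two_steps: n => [||n IHn IHn1]; rewrite ?mul0r ?cos0 ?mul1r//.
rewrite chebyshevSS IHn IHn1 -{1}xK.
set t := acos _.
have -> : n.+2%:R * t = n.+1%:R * t + t by rewrite -natr1; ring.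
have -> : n%:R * t = n.+1%:R * t - t by rewrite -natr1; ring.
by rewrite !cosD cosN sinN; ring.
Qed.

Lemma chebyshev_mulX n x : x * T n.+1 x = r / 2 * (T n.+2 x + T n x).
Proof. by rewrite chebyshevSS; field; rewrite gt_eqF. Qed.

(** From index 3 on the recurrence has the constant coefficient r^2 / 4 of the
    rescaled Chebyshev polynomials; the values of omega at 1 and 2 are those for
    which the two initial conditions produce the combination T_{n+2} - q T_n. *)
Lemma monic_ops_chebyshev n x :
  P n.+2 x = 2 * (r / 2) ^+ n.+2 * (T n.+2 x - q * T n x).
Proof.
have s1N0 : 1 + s != 0 by rewrite gt_eqF// ltr_wpDr// ltW.
have q2 : r ^+ 2 * (1 + q) = 2 * (1 - s) by rewrite r2s /q; field.
have rN0 : r != 0 by rewrite gt_eqF.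
elim/nat_ind_two_steps: n => [||n IHn IHn1].
- apply/eqP; rewrite -subr_eq0 /= -/s.
  set d := (X in X == 0).
  have -> : d = (r ^+ 2 * (1 + q) - 2 * (1 - s)) / 2 by rewrite /d; field.
  by rewrite q2 subrr mul0r.
- apply/eqP; rewrite -subr_eq0 /= -/s.
  set d := (X in X == 0).
  have -> : d = x * ((r ^+ 2 * (1 + q) - 2 * (1 - s)) / 4 +
    (r ^+ 2 - (1 - s) * (1 + s)) / 2) by rewrite /d; field.
  by rewrite q2 r2s !subrr !mul0r addr0 mulr0.
rewrite monic_opsSS IHn IHn1.
transitivity (2 * (r / 2) ^+ n.+4 * (2 * (x / r) * T n.+3 x - T n.+2 x -
    q * (2 * (x / r) * T n.+1 x - T n x))); last by rewrite -!chebyshevSS.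
have -> : omega r n.+3 = r ^+ 2 / 4 by [].
rewrite (exprS _ n.+3) !(exprS _ n.+2).
move: (_ ^+ n.+2) (T n.+3 x) (T n.+2 x) (T n.+1 x) (T n x) => k t3 t2 t1 t0.
by field.
Qed.

(** The mean of (1 - x^2) T_n is s / pi times the integral of cos (n t) over
    [0, pi]. For n >= 1 this is read off from the nonnegative function
    1 + cos (n t). *)
Lemma konno_mean_weight n : L (fun x => (1 - x ^+ 2) * T n x) = s * (n == 0%N)%:R.
Proof.
have cw : continuous (fun x : R => 1 - x ^+ 2).
  by move=> x; apply: cvgB; [exact: cvg_cst|exact: exprn_continuous].
have Lw0 : L (fun x => 1 - x ^+ 2) = s.
  rewrite /konno_mean /Rintegral.
  rewrite (@integral_konno_weight _ _ r01 (fun _ => 1) (fun t => t))//=.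
  - by rewrite subr0 divfK// gt_eqF ?pi_gt0.
  - by move=> x; exact: cvg_cst.
  - by move=> x xr; rewrite mul1r.
case: n => [|n].
  by rewrite mulr1 -Lw0; apply: eq_konno_mean => x _; rewrite mulr1.
rewrite mulr0.
have cwT : continuous (fun x : R => (1 - x ^+ 2) * T n.+1 x).
  by move=> x; apply: cvgM; [exact: cw|exact: continuous_chebyshev].
suff : L (fun x => (1 - x ^+ 2) * (1 + T n.+1 x)) = s.
  rewrite (_ : (fun x => _) = (fun x => 1 - x ^+ 2) \+ (fun x => (1 - x ^+ 2) * T n.+1 x)).
    by rewrite konno_meanD// Lw0 => sE; apply: (addrI s); rewrite addr0.
  by apply/funext => x /=; ring.
have nN0 : n.+1%:R != 0 :> R by rewrite pnatr_eq0.
have dPhi (t : R) : is_derive t 1 (fun t : R => t + sin (n.+1%:R * t) / n.+1%:R)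
    (1 + cos (n.+1%:R * t)).
  apply: is_deriveD.
  have d1 : is_derive t 1 (fun t : R => n.+1%:R * t) n.+1%:R.
    by apply: is_derive_eq; rewrite [_%:A]mulr1.
  have d2 := is_derive1_comp (is_derive_sin (n.+1%:R * t)) d1.
  rewrite (_ : (fun t => _) = n.+1%:R^-1 \*: (sin \o (fun t : R => n.+1%:R * t))); last first.
    by apply/funext => u /=; rewrite mulrC.
  apply: is_derive_eq.
  by rewrite /GRing.scale/=; field.
rewrite /konno_mean /Rintegral.
rewrite (@integral_konno_weight _ _ r01 (fun t => 1 + cos (n.+1%:R * t)) _ _ _ _ dPhi)//.
- by rewrite mulr0 sin0 mul0r addr0 subr0 sin_natpi mul0r addr0 divfK// gt_eqF ?pi_gt0.
- move=> x; apply: cvgD; first exact: cvg_cst.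
  by apply: continuous_comp; [apply: cvgM; [exact: cvg_cst|exact: cvg_id]|exact: continuous_cos].
- move=> x; apply: cvgM; first exact: cw.
  by apply: cvgD; [exact: cvg_cst|exact: continuous_chebyshev].
- by move=> x xr; rewrite chebyshev_acos// mulrC.
Qed.

(* e_rec, e_rec0 and e_rec1 are [konno_mean_weight] after expansion of x^2 T_n;
   the last two account for the boundary values of the recurrence. *)
Let e n := L (T n).

Let e_lin (a b c : R) i j k :
  L (fun x => a * T i x + b * T j x + c * T k x) = a * e i + b * e j + c * e k.
Proof.
have cT d l : continuous (fun x : R => d * T l x).
  by move=> x; apply: cvgM; [exact: cvg_cst|exact: continuous_chebyshev].
have cT2 : continuous (fun x : R => a * T i x + b * T j x).
  by move=> x; apply: cvgD; exact: cT.
rewrite (@konno_meanD _ _ r01 (fun x => a * T i x + b * T j x) (fun x => c * T k x))//.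
rewrite (@konno_meanD _ _ r01 (fun x => a * T i x) (fun x => b * T j x))//.
by rewrite !konno_meanZ//; exact: continuous_chebyshev.
Qed.

Let e_rec n : (1 - r ^+ 2 / 2) * e n.+2 = r ^+ 2 / 4 * (e n.+4 + e n).
Proof.
have := konno_mean_weight n.+2; rewrite mulr0.
rewrite (_ : (fun x => _) = (fun x => (1 - r ^+ 2 / 2) * T n.+2 x +
  (- (r ^+ 2 / 4)) * T n.+4 x + (- (r ^+ 2 / 4)) * T n x)) ?e_lin; first by lra.
apply/funext => x.
rewrite mulrBl mul1r expr2 -mulrA chebyshev_mulX [x * (_ * _)]mulrCA mulrDr !chebyshev_mulX.
by field.
Qed.

Let e_rec0 : (1 - r ^+ 2 / 2) * e 0 - r ^+ 2 / 2 * e 2 = s.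
Proof.
have := konno_mean_weight 0; rewrite mulr1.
rewrite (_ : (fun x => _) = (fun x => (1 - r ^+ 2 / 2) * T 0 x +
  (- (r ^+ 2 / 2)) * T 2 x + 0 * T 0 x)) ?e_lin; first by lra.
by apply/funext => x /=; field; rewrite gt_eqF.
Qed.

Let e_rec1 : (1 - 3 * r ^+ 2 / 4) * e 1 = r ^+ 2 / 4 * e 3.
Proof.
have := konno_mean_weight 1; rewrite mulr0.
rewrite (_ : (fun x => _) = (fun x => (1 - 3 * r ^+ 2 / 4) * T 1 x +
  (- (r ^+ 2 / 4)) * T 3 x + 0 * T 0 x)) ?e_lin; first by lra.
by apply/funext => x /=; field; rewrite gt_eqF.
Qed.

Let e_bound n : `|e n| <= e 0.
Proof.
apply: konno_mean_norm => //; first exact: continuous_chebyshev.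
move=> x xr; rewrite chebyshev_acos// ler_norml cos_geN1 cos_le1//.
Qed.

Let r2q : r ^+ 2 / 4 * (q + q^-1) = 1 - r ^+ 2 / 2.
Proof.
rewrite r2s /q; field.
by rewrite gt_eqF ?ltr_wpDr ?ltW//= gt_eqF ?subr_gt0.
Qed.

(* The defect d_n = e_{n+2} - q e_n is multiplied by 1 / q > 1 at every step of
   length two, so boundedness of e forces it to vanish. *)
Let e_geometric n : e n.+2 = q * e n.
Proof.
have e0 : 0 <= e 0 by rewrite (le_trans _ (e_bound 0)).
have step k : e (n + k.*2).+2 - q * e (n + k.*2)%N = q ^- k * (e n.+2 - q * e n).
  elim: k => [|k IHk]; first by rewrite addn0 expr0 invr1 mul1r.
  rewrite exprS invfM -(mulrA q^-1) -IHk doubleS !addnS.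
  have c0 : r ^+ 2 / 4 != 0 by rewrite gt_eqF// divr_gt0// exprn_gt0.
  have := e_rec (n + k.*2); rewrite -r2q -(mulrA (r ^+ 2 / 4)) => /(mulfI c0).
  move/eqP; rewrite -subr_eq => /eqP <-;
  by field; rewrite gt_eqF.
have small k : `|e n.+2 - q * e n| <= q ^+ k * (2 * e 0).
  have -> : e n.+2 - q * e n = q ^+ k * (e (n + k.*2).+2 - q * e (n + k.*2)%N).
    by rewrite step mulVKf// expf_neq0// gt_eqF.
  rewrite normrM ger0_norm ?exprn_ge0 ?(ltW q0)// ler_wpM2l ?exprn_ge0 ?(ltW q0)//.
  have := ler_normB (e (n + k.*2).+2) (q * e (n + k.*2)%N).
  rewrite normrM (ger0_norm (ltW q0)).
  have := e_bound (n + k.*2).+2; have := e_bound (n + k.*2).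
  have := normr_ge0 (e (n + k.*2)); have := q1; have := q0; nra.
have : (fun k => q ^+ k * (2 * e 0)) @ \oo --> 0 * (2 * e 0).
  apply: cvgM; last exact: cvg_cst.
  by apply: cvg_expr; rewrite ger0_norm// ltW.
rewrite mul0r => qk.
have : `|e n.+2 - q * e n| <= 0.
  rewrite -(cvg_lim (@Rhausdorff R) qk).
  by apply: limr_ge; [apply/cvg_ex; exists 0|apply: nearW].
by rewrite normr_le0 subr_eq0 => /eqP.
Qed.

(** Expansion in the means e_n of the Chebyshev polynomials: e 0 = 1 by e_rec0,
    e 1 = 0 by e_rec1, and T_{n+2} - q T_n has mean zero. *)
Lemma konno_mean_monic_ops n : L (P n) = (n == 0%N)%:R.
Proof.
case: n => [|[|n]].
- have q2 : r ^+ 2 * (1 + q) = 2 * (1 - s).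
    by rewrite r2s /q; field; rewrite gt_eqF// ltr_wpDr// ltW.
  have := e_rec0; rewrite e_geometric => es.
  apply: (@mulfI _ s); first by rewrite gt_eqF.
  rewrite /= mulr1 -/(e 0) -[RHS]es.
  have -> : s = 1 - r ^+ 2 * (1 + q) / 2 by rewrite q2; field.
  by field.
- rewrite mulr0n (_ : P 1 = (fun x => r * T 1 x)); last first.
    by apply/funext => x /=; field; rewrite gt_eqF.
  rewrite konno_meanZ//; last exact: continuous_chebyshev.
  suff : e 1 = 0 by rewrite /e => ->; rewrite mulr0.
  have := e_rec1; rewrite e_geometric (mulrA (r ^+ 2 / 4)) => /eqP.
  rewrite -subr_eq0 -mulrBl mulf_eq0 => /orP[|/eqP//].
  have -> : 1 - 3 * r ^+ 2 / 4 - r ^+ 2 / 4 * q = r ^+ 2 / 4 * (q^-1 - 1).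
    have -> : 1 - 3 * r ^+ 2 / 4 = 1 - r ^+ 2 / 2 - r ^+ 2 / 4 by field.
    by rewrite -r2q; field; rewrite gt_eqF.
  rewrite mulf_eq0 subr_eq0 invr_eq1 (lt_eqF q1) orbF.
  by rewrite gt_eqF// divr_gt0// exprn_gt0.
have -> : P n.+2 = (fun x => 2 * (r / 2) ^+ n.+2 * T n.+2 x +
    (- (2 * (r / 2) ^+ n.+2 * q)) * T n x + 0 * T 0 x).
  by apply/funext => x; rewrite monic_ops_chebyshev mul0r addr0; move: (_ ^+ _) => c; ring.
by rewrite e_lin e_geometric [RHS]mulr0n; ring.
Qed.
End konno_ops.

(** * Bounds and limits in Hilbert space *)

Section hilbert.
Local Open Scope complex_scope.
Context (R : realType) (H : hilbertType R).
Implicit Types x y : H.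

Lemma inner_self x : inner x x = (complex.Re (inner x x))%:C.
Proof.
have := innerC x x; case: (inner x x) => a b [] /eqP.
by rewrite -addr_eq0 -mulr2n mulrn_eq0 => /eqP ->.
Qed.

Lemma Re_inner_ge0 x : 0 <= complex.Re (inner x x).
Proof. by rewrite -lecR -inner_self -normr_inner exprn_ge0. Qed.

(** Additive form of the Cauchy-Schwarz inequality, from the positivity of
    <x + y, x + y> and <x - y, x - y>. *)
Lemma Re_inner_amgm x y :
  `|complex.Re (inner x y)| <= (complex.Re (inner x x) + complex.Re (inner y y)) / 2.
Proof.
have := Re_inner_ge0 (x + y); have := Re_inner_ge0 (x - y).
rewrite !innerBl !innerBr !innerDl !innerDr.
rewrite (innerC x y); case: (inner x x) => a b; case: (inner y y) => c d.
by case: (inner x y) => e f /= h1 h2; rewrite ler_norml; apply/andP; split; lra.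
Qed.

Lemma continuous_inner_bound (B : {linear H -> H}) : continuous B ->
  exists2 k : R, 0 <= k & forall x,
    complex.Re (inner (B x) (B x)) <= k * complex.Re (inner x x).
Proof.
move=> /linear_bounded_continuous/linear_boundedP/pinfty_ex_gt0[[k i] /= k0 Bk].
have {k0 Bk} [k0 Bk] : 0 < k /\ forall x, `|B x| <= k%:C * `|x|.
  by move: k0 Bk; rewrite ltcE /= => /andP[/eqP -> k0].
exists (k ^+ 2); first exact: sqr_ge0.
move=> x.
have nE (z : H) : (complex.Re (inner z z))%:C = `|z| ^+ 2 by rewrite normr_inner [RHS]inner_self.
rewrite -lecR [leRHS](_ : _ = (k%:C * `|x|) ^+ 2); last first.
  by rewrite exprMn -nE -rmorphXn -rmorphM.
rewrite nE; apply: lerXn2r (Bk x); rewrite nnegrE//.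
by rewrite mulr_ge0// lecR ltW.
Qed.

(** By polarization, continuity reduces to that of the norm. *)
Lemma cvg_Re_inner (I : Type) (F : set_system I) {FF : Filter F} (u : I -> H) (l x : H) :
  u @ F --> l -> complex.Re (inner (u i) x) @[i --> F] --> complex.Re (inner l x).
Proof.
move=> ul.
have polar y z : complex.Re (inner y z) =
    complex.Re (`|y + z| ^+ 2 - `|y - z| ^+ 2) / 4.
  rewrite !normr_inner !innerBl !innerBr !innerDl !innerDr (innerC y z).
  case: (inner y y) => a b; case: (inner z z) => c d.
  by case: (inner y z) => e f /=; field.
under eq_fun do rewrite polar.
rewrite polar; apply: cvgM; last exact: cvg_cst.
suff : (`|u i + x| ^+ 2 - `|u i - x| ^+ 2 : R[i]^o) @[i --> F] -->
    (`|l + x| ^+ 2 - `|l - x| ^+ 2 : R[i]^o).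
  move=> cv; apply/cvgrPdist_lt => e e0.
  have ec : 0 < e%:C by rewrite ltcR.
  move/cvgrPdist_lt : cv => /(_ _ ec); apply: filterS => n.
  rewrite -ltcR; apply: le_lt_trans.
  by rewrite -raddfB; exact: normc_ge_Re.
apply: cvgB; rewrite expr2; under eq_fun do rewrite expr2.
  by apply: cvgM; apply: cvg_norm; apply: cvgD => //; exact: cvg_cst.
by apply: cvgM; apply: cvg_norm; apply: cvgB => //; exact: cvg_cst.
Qed.

End hilbert.

(** * Vacuum moments of the Jacobi operator *)

Section jacobi.
Local Open Scope complex_scope.
Context (R : realType) (H : hilbertType R) (r : R).
Hypothesis r01 : 0 < r < 1.
Variables (A : {linear H -> H}) (Psi : nat -> H).
Hypothesis A0 : A (Psi 0%N) = Psi 1%N.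
Hypothesis AS : forall n, A (Psi n.+1) = Psi n.+2 + (omega r n.+1)%:C *: Psi n.
Hypothesis Psi0 : forall n, inner (Psi n) (Psi 0%N) = (n == 0%N)%:R.

(** The graph of the correspondence between vectors p(A) Psi_0 and polynomials
    p, as the real span of the pairs (Psi n, P_n). A relation avoids both
    operator polynomials and the uniqueness of coefficients. *)
Inductive jacobi_model : H -> (R -> R) -> Prop :=
| jacobi_model_base n : jacobi_model (Psi n) (monic_ops (omega r) n)
| jacobi_modelD u v f g : jacobi_model u f -> jacobi_model v g ->
    jacobi_model (u + v) (f \+ g)
| jacobi_modelZ c u f : jacobi_model u f ->
    jacobi_model (c%:C *: u) (fun x => c * f x).

Lemma jacobi_model_continuous u f : jacobi_model u f -> continuous f.
Proof.
elim => [n|v w g h _ cg _ ch x|c v g _ cg x].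
- exact: continuous_monic_ops.
- by apply: cvgD; [exact: cg|exact: ch].
- by apply: cvgM; [exact: cvg_cst|exact: cg].
Qed.

Lemma jacobi_model_mean u f : jacobi_model u f ->
  complex.Re (inner u (Psi 0%N)) = konno_mean r f.
Proof.
elim => [n|v w g h mg IHg mh IHh|c v g mg IHg].
- by rewrite konno_mean_monic_ops// Psi0; case: n.
- rewrite (konno_meanD r01 (jacobi_model_continuous mg) (jacobi_model_continuous mh)).
  by rewrite innerDl raddfD /= IHg IHh.
- rewrite (konno_meanZ r01 c (jacobi_model_continuous mg)).
  by rewrite innerZl -IHg; case: (inner v _) => x y /=; rewrite mul0r subr0.
Qed.

Lemma jacobi_modelX u f : jacobi_model u f -> jacobi_model (A u) (fun x => x * f x).
Proof.
elim => [[|n]|v w g h _ mg _ mh|c v g _ mg].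
- rewrite A0 (_ : (fun x => _) = monic_ops (omega r) 1); first exact: jacobi_model_base.
  by apply/funext => x /=; rewrite mulr1.
- rewrite AS (_ : (fun x => _) = monic_ops (omega r) n.+2 \+
    (fun x => omega r n.+1 * monic_ops (omega r) n x)).
    by apply: jacobi_modelD; [|apply: jacobi_modelZ]; exact: jacobi_model_base.
  by apply/funext => x; rewrite /= subrK.
- rewrite linearD (_ : (fun x => _) = (fun x => x * g x) \+ (fun x => x * h x)).
    exact: jacobi_modelD.
  by apply/funext => x /=; rewrite mulrDr.
- rewrite linearZ /= (_ : (fun x => _) = (fun x => c * (x * g x))).
    exact: jacobi_modelZ.
  by apply/funext => x /=; rewrite mulrCA.
Qed.


(** The vector (A + M)^k Psi_0 corresponds to the polynomial (x + M)^k. *)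
Lemma jacobi_moment (M : R) (S : {linear H -> H}) k :
  (forall x, S x = A x + M%:C *: x) -> r <= M ->
  (\int[konno r]_x (`|x - (- M)| ^+ k)%:E =
   (complex.Re (inner (iter k S (Psi 0%N)) (Psi 0%N)))%:E)%E.
Proof.
move=> SE rM.
have model : jacobi_model (iter k S (Psi 0%N)) (fun x => (x + M) ^+ k).
  elim: k => [|k IHk]; first exact: jacobi_model_base 0%N.
  rewrite iterS SE (_ : (fun x => _) =
    (fun x => x * (x + M) ^+ k) \+ (fun x => M * (x + M) ^+ k)).
    by apply: jacobi_modelD; [exact: jacobi_modelX|exact: jacobi_modelZ].
  by apply/funext => x /=; rewrite exprS mulrDl.
have cM : continuous (fun x : R => (x + M) ^+ k).
  exact: jacobi_model_continuous model.
rewrite (jacobi_model_mean model) integral_konno_itv//; last first.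
  apply/measurable_EFinP; apply: measurable_funX; apply: measurableT_comp => //.
  exact: measurable_funB.
rewrite /konno_mean /Rintegral fineK; last first.
  exact: integrable_fin_num (integrable_konno r01 cM).
apply: eq_integral => x; rewrite inE /= in_itv/= => /andP[rx _].
by rewrite opprK ger0_norm//; lra.
Qed.
End jacobi.

(** * The quantum walk operators *)

Local Arguments omega : simpl never.

Section quantum_walk.
Local Open Scope complex_scope.
Context (R : realType) (r : R).
Hypothesis r01 : 0 < r < 1.
Context (H : hilbertType R) (Phi : nat -> H) (Bp Bm : {linear H -> H}).
Hypotheses (hPhi : complete_orthonormal Phi).
Hypotheses (hBp : is_creation r Phi Bp) (hBm : is_annihilation r Phi Bm).

Lemma omega_gt0 n : 0 < omega r n.
Proof.
have /andP[r0 r1] := r01.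
have s1 : sqrtr (1 - r ^+ 2) < 1.
  by rewrite -[ltRHS]sqrtr1 ltr_sqrt ?ltr01// ltrBlDr ltrDl exprn_gt0.
have s0 : 0 < sqrtr (1 - r ^+ 2) by rewrite sqrtr_gt0; nra.
case: n => [|[|[|n]]]; rewrite /omega.
- by rewrite divr_gt0// exprn_gt0.
- by rewrite subr_gt0.
- by rewrite mulr_gt0 ?divr_gt0// subr_gt0.
- by rewrite divr_gt0// exprn_gt0.
Qed.

(** Normalization that turns the symmetric recurrence of A on the Phi_n into the
    monic one. *)
Definition monic_vector n : H :=
  (\prod_(i < n) sqrtr (omega r i.+1))%:C *: Phi n.

Lemma monic_vector0 : monic_vector 0 = Phi 0%N.
Proof. by rewrite /monic_vector big_ord0 scale1r. Qed.

Lemma inner_monic_vector n : inner (monic_vector n) (monic_vector 0) = (n == 0%N)%:R.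
Proof.
rewrite monic_vector0 innerZl hPhi.1; case: n => [|n]; last by rewrite mulr0.
by rewrite big_ord0 mulr1.
Qed.

(** The limit operator of the rescaled walk. *)
Definition quadrature : {linear H -> H} := Bp \+ Bm.

Lemma quadrature0 : quadrature (monic_vector 0) = monic_vector 1.
Proof.
have [_ Bm0 _] := hBm.
by rewrite /quadrature /= monic_vector0 Bm0 addr0 hBp.2 /monic_vector big_ord1.
Qed.

Lemma quadratureS n : quadrature (monic_vector n.+1) =
  monic_vector n.+2 + (omega r n.+1)%:C *: monic_vector n.
Proof.
have [_ _ BmS] := hBm.
rewrite /quadrature /= /monic_vector !linearZ /= hBp.2 BmS !scalerA.
rewrite -!rmorphM [in RHS]big_ord_recr /=; congr (_ + _%:C *: _).
by rewrite big_ord_recr /= -mulrA -expr2 sqr_sqrtr ?(ltW (omega_gt0 _))// mulrC.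
Qed.

(** eps stands for 1 / sqrt(lambda), and M is a shift making the operator
    nonnegative. Being a linear map by construction, it can be used where the
    plain function [ZQW] cannot. *)
Definition shifted_walk (eps M : R) : {linear H -> H} :=
  (quadrature \+ (eps%:C \*: (Bp \o Bm))) \+ M%:C \*: idfun.

Lemma shifted_walkE eps M x : shifted_walk eps M x =
  Bp x + Bm x + eps%:C *: Bp (Bm x) + M%:C *: x.
Proof. by []. Qed.

Lemma ZQW_shifted M lambda x : 0 < lambda ->
  shifted_walk (sqrtr lambda)^-1 M x =
  (sqrtr (omega r 1))%:C *: ZQW r Bp Bm lambda x + M%:C *: x.
Proof.
move=> l0; congr (_ + _).
have w0 := omega_gt0 1.
have sw0 : sqrtr (omega r 1) != 0 by rewrite gt_eqF// sqrtr_gt0.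
have sl0 : sqrtr lambda != 0 by rewrite gt_eqF// sqrtr_gt0.
have slE : lambda = sqrtr lambda * sqrtr lambda by rewrite -expr2 sqr_sqrtr ?ltW.
rewrite /ZQW scalerA -rmorphM sqrtrM ?(ltW l0)// invfM mulrCA divff// mulr1.
have -> : PQW Bp Bm lambda x - lambda%:C *: x =
    (sqrtr lambda)%:C *: (Bp x + Bm x) + Bp (Bm x).
  have -> : lambda%:C = (sqrtr lambda)%:C * (sqrtr lambda)%:C by rewrite -rmorphM -slE.
  rewrite /PQW /= [Bp (_ + _)]linearD [Bp (_ *: x)]linearZ /=.
  by rewrite !scalerDr scalerA addrA addrK -addrA addrC.
by rewrite scalerDr scalerA -rmorphM mulVf// scale1r.
Qed.

(** One constant M serves all eps in [0, 1]: this is the uniform bound on the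
    supports. *)
Lemma shifted_walk_bound : exists2 M, r <= M & forall eps x, 0 <= eps <= 1 ->
  0 <= complex.Re (inner (shifted_walk eps M x) x) <= 2 * M * complex.Re (inner x x).
Proof.
have [k1 k10 k1P] := continuous_inner_bound hBp.1.
have [cBm _ _] := hBm.
have [k2 k20 k2P] := continuous_inner_bound cBm.
pose M := (k1 + 1) / 2 + (k2 + 1) / 2 + (k1 * k2 + 1) / 2 + 1.
have k12 : 0 <= k1 * k2 by rewrite mulr_ge0.
exists M; first by rewrite /M; case/andP: r01 => _ r1; lra.
move=> eps x /andP[e0 e1].
have n0 := Re_inner_ge0 x.
have h1 := Re_inner_amgm (Bp x) x; have h2 := Re_inner_amgm (Bm x) x.
have h3 := Re_inner_amgm (Bp (Bm x)) x.
have h4 := k1P x; have h5 := k2P x; have h6 := k1P (Bm x).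
have h7 : k1 * complex.Re (inner (Bm x) (Bm x)) <= k1 * k2 * complex.Re (inner x x).
  by rewrite -mulrA ler_wpM2l.
rewrite shifted_walkE !innerDl !innerZl.
have ReZ (a : R) (z : R[i]) : complex.Re (a%:C * z) = a * complex.Re z.
  by case: z => u v /=; rewrite mul0r subr0.
have ReD (y z : R[i]) : complex.Re (y + z) = complex.Re y + complex.Re z.
  by case: y z => ? ? [].
rewrite !ReD !ReZ.
have {}h3 : `|eps * complex.Re (inner (Bp (Bm x)) x)| <=
    (complex.Re (inner (Bp (Bm x)) (Bp (Bm x))) + complex.Re (inner x x)) / 2.
  by rewrite normrM (ger0_norm e0) (le_trans _ h3)// ler_piMl.
have MN : M * complex.Re (inner x x) = (k1 * complex.Re (inner x x) +
    k2 * complex.Re (inner x x) + k1 * k2 * complex.Re (inner x x)) / 2 +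
    5 / 2 * complex.Re (inner x x) by rewrite /M; field.
rewrite -mulrA MN.
move: h1 h2 h3; rewrite !ler_norml => /andP[? ?] /andP[? ?] /andP[? ?].
by apply/andP; split; lra.
Qed.


Lemma cvg_invr_sqrtr : (sqrtr lambda)^-1 @[lambda --> +oo] --> (0 : R).
Proof.
apply/cvgr0Pnorm_lt => e e0; near=> l.
have l0 : e ^- 2 < l by near: l; apply: nbhs_pinfty_gt; rewrite num_real.
have l00 : 0 < l by apply: lt_trans l0; rewrite invr_gt0 exprn_gt0.
rewrite ger0_norm ?invr_ge0 ?sqrtr_ge0//.
rewrite -[ltRHS]invrK ltf_pV2 ?posrE ?invr_gt0 ?sqrtr_gt0//.
rewrite -[ltLHS]ger0_norm ?invr_ge0 ?(ltW e0)// -sqrtr_sqr ltr_sqrt//.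
by rewrite exprVn.
Unshelve. all: by end_near. Qed.

Lemma cvg_iter_shifted_walk M k x :
  iter k (shifted_walk (sqrtr lambda)^-1 M) x @[lambda --> +oo] -->
  iter k (shifted_walk 0 M) x.
Proof.
have cBp := hBp.1; have [cBm _ _] := hBm.
elim: k => [|k IHk]; first exact: cvg_cst.
have ec : ((sqrtr lambda)^-1%:C : R[i]^o) @[lambda --> +oo] --> (0%:C : R[i]^o).
  apply/cvgr0Pnorm_lt => -[e i]; rewrite ltcE /= => /andP[/eqP -> e0].
  have /cvgr0Pnorm_lt /(_ _ e0) := cvg_invr_sqrtr.
  by apply: filterS => l; rewrite -ltcR normc_def /= expr0n addr0 sqrtr_sqr.
rewrite iterS shifted_walkE.
under eq_fun do rewrite iterS shifted_walkE.
have cB (B : {linear H -> H}) : continuous B ->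
    forall (u : R -> H) l, u lambda @[lambda --> +oo] --> l ->
    B (u lambda) @[lambda --> +oo] --> B l.
  by move=> cB u l ul; apply: continuous_cvg ul; exact: cB.
have BmI := cB _ cBm _ _ IHk.
apply: cvgD; last exact: cvgZ (cvg_cst (M%:C : R[i]^o)) IHk.
apply: cvgD; first by apply: cvgD BmI; exact: cB _ cBp _ _ IHk.
exact: cvgZ ec (cB _ cBp _ _ BmI).
Qed.


Section spectral.
Variables (lambda M : R) (E : pvm H).
Hypothesis lambda_ge1 : 1 <= lambda.
Hypothesis hE : spectral_measure_of (ZQW r Bp Bm lambda) E.
Let c := sqrtr (omega r 1).
Let S := shifted_walk (sqrtr lambda)^-1 M.
Hypothesis hM : forall x,
  0 <= complex.Re (inner (S x) x) <= 2 * M * complex.Re (inner x x).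

Let lambda_gt0 : 0 < lambda. Proof. exact: lt_le_trans lambda_ge1. Qed.

Let integrable_affine a b x :
  (pvm_dist E x).-integrable setT (EFin \o (fun t => a * t + b)).
Proof.
have [it _] := hE x.
have -> : EFin \o (fun t : R => a * t + b) = (fun t => a%:E * t%:E + b%:E)%E.
  by apply/funext => t /=; rewrite EFinD EFinM.
apply: integrableD => //; first exact: integrableZl.
apply: (@measurable_bounded_integrable _ _ _ (pvm_dist E x) (cst b)) => //.
  by rewrite [X in (X < _)%E](pvm_distT E x) ltry.
by exists `|b|; split => // y by_ t _; exact: ltW.
Qed.

Let integral_affine a b x : \int[pvm_dist E x]_t (a * t + b) =
  complex.Re (inner (a%:C *: ZQW r Bp Bm lambda x + b%:C *: x) x).
Proof.
have [it itE] := hE x.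
have ib := integrable_affine 0 b x.
rewrite (_ : (fun t : R => a * t + b) = (fun t => a * t) \+ cst b)//.
rewrite RintegralD//; last 2 first.
- exact: (integrableZl measurableT a it).
- apply: eq_integrable ib => // t _ /=; by rewrite mul0r add0r.
rewrite (RintegralZl _ measurableT it) Rintegral_cst//.
rewrite [X in b * fine X](pvm_distT E x) innerDl (innerZl a%:C) (innerZl b%:C) itE.
by case: (inner x x) => u v /=; rewrite !mul0r !subr0.
Qed.

Let walkE x : S x = c%:C *: ZQW r Bp Bm lambda x + M%:C *: x.
Proof. exact: ZQW_shifted lambda_gt0. Qed.

Let inner_SE x : inner (S x) x = (\int[pvm_dist E x]_t (c * t + M))%:C.
Proof.
rewrite integral_affine walkE innerDl (innerZl c%:C) (innerZl M%:C).
by rewrite (hE x).2 inner_self -!rmorphM -rmorphD.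
Qed.

(** [spectral_moment] for the symbol g t = c t + M, transported by the
    dilation t |-> c t. *)
Lemma integral_walk_moment k x :
  (\int[dilation c (pvm_dist E x)]_y (`|y - (- M)| ^+ k)%:E =
   (complex.Re (inner (iter k S x) x))%:E)%E.
Proof.
rewrite /dilation ge0_integral_pushforward//.
- rewrite preimage_setT -(@spectral_moment _ _ E S (fun t => c * t + M)).
  + by apply: eq_integral => t _; rewrite /= opprK.
  + apply: measurable_funD => //; exact: measurable_funM.
  + by move=> y; exact: integrable_affine.
  + exact: inner_SE.
  + by move=> y; case/andP: (hM y).
- exact: measurable_funM.
- apply/measurable_EFinP; apply: measurable_funX; apply: measurableT_comp => //.
  exact: measurable_funB.
Qed.

(** The two ends of the support come from nonnegativity of S and of 2 M - S. *)
Lemma walk_dist_support x :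
  dilation c (pvm_dist E x) (~` `[- M, M]) = 0%E.
Proof.
have mg a b : measurable_fun setT (fun t : R => a * t + b).
  by apply: measurable_funD => //; exact: measurable_funM.
have mlt0 a b : measurable [set t : measurableTypeR R | a * t + b < 0].
  rewrite (_ : [set _ | _] = (fun t => a * t + b) @^-1` `]-oo, 0[); last first.
    by apply/seteqP; split => t /=; rewrite in_itv.
  by rewrite -[X in measurable X]setTI; exact: mg.
have lt0 : pvm_dist E x [set t | c * t + M < 0] = 0%E.
  apply: (@spectral_dist_lt0 _ _ E S); first exact: mg.
  - by move=> y; exact: integrable_affine.
  - exact: inner_SE.
  - by move=> y; case/andP: (hM y).
have gt0 : pvm_dist E x [set t | - c * t + M < 0] = 0%E.
  pose S' : {linear H -> H} := ((2 * M)%:C \*: idfun) \- S.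
  have S'E y : inner (S' y) y = (2 * M)%:C * inner y y - inner (S y) y.
    by rewrite /S' /= innerBl innerZl.
  apply: (@spectral_dist_lt0 _ _ E S'); first exact: mg.
  - by move=> y; exact: integrable_affine.
  - move=> y; rewrite S'E integral_affine walkE !innerDl (innerZl c%:C) (innerZl M%:C).
    rewrite (innerZl (- c)%:C) (hE y).2 inner_self.
    by rewrite -!rmorphM -rmorphD -rmorphB /=; congr (_%:C); ring.
  - move=> y; rewrite S'E inner_self; have /andP[_] := hM y.
    by case: (inner (S y) y) => u v /=; rewrite mul0r subr0 subr_ge0.
rewrite /dilation /pushforward.
rewrite (_ : _ @^-1` _ = [set t | c * t + M < 0] `|` [set t | - c * t + M < 0]).
  by rewrite measureU0//; exact: mlt0.
apply/seteqP; split => t /=; rewrite in_itv/= mulNr.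
  by move/negP; rewrite negb_and -!ltNge => /orP[|] h; [left|right]; lra.
by move=> h; apply/negP; rewrite negb_and -!ltNge; apply/orP; case: h => h; [left|right]; lra.
Qed.

End spectral.

End quantum_walk.

Theorem theorem6p3 (R : realType) (r : R) (hr : 0 < r < 1)
  (H : hilbertType R) (Phi : nat -> H) (hPhi : complete_orthonormal Phi)
  (Bp Bm : {linear H -> H})
  (hBp : is_creation r Phi Bp) (hBm : is_annihilation r Phi Bm)
  (E : R -> pvm H)
  (hE : forall lambda : R, 0 < lambda ->
     spectral_measure_of (ZQW r Bp Bm lambda) (E lambda)) :
  weak_cvg (+oo : set_system R)
    (fun lambda => dilation (sqrtr (omega r 1)) (pvm_dist (E lambda) (Phi 0%N)))
    (konno r).
Proof.
have [M rM hM] := shifted_walk_bound hr hBp hBm.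
have M0 : 0 < M by case/andP: hr => r0 _; exact: lt_le_trans rM.
apply: (@moments_weak_cvg _ _ _ _ _ _ (- M) M
  (fun lambda k => complex.Re (inner
     (iter k (shifted_walk Bp Bm (sqrtr lambda)^-1 M) (Phi 0%N)) (Phi 0%N)))
  (fun k => complex.Re (inner
     (iter k (shifted_walk Bp Bm 0 M) (Phi 0%N)) (Phi 0%N)))).
- by lra.
- near=> lambda.
  have l1 : 1 <= lambda by near: lambda; apply: nbhs_pinfty_ge; rewrite num_real.
  have l0 : 0 < lambda by exact: lt_le_trans l1.
  have sl : 0 <= (sqrtr lambda)^-1 <= 1.
    rewrite invr_ge0 sqrtr_ge0 invf_le1 ?sqrtr_gt0//.
    by rewrite -[leLHS]sqrtr1 ler_sqrt ?(ltW l0).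
  split => [|k].
    by apply: (walk_dist_support hr l1 (hE _ l0)) => x; exact: hM.
  by apply: (integral_walk_moment hr l1 (hE _ l0)) => x; exact: hM.
- have mC : measurable (~` `[- M, M]%classic : set (measurableTypeR R)).
    exact: measurableC.
  apply: (@subset_measure0 _ _ _ (konno r) _ (~` `]- r, r[%classic)) => //.
  + exact: measurableC.
  + apply: subsetC => x /=; rewrite !in_itv/= => /andP[? ?].
    by apply/andP; split; lra.
  + exact: konno_setC.
- move=> k; rewrite -(monic_vector0 r Phi).
  apply: (jacobi_moment hr (quadrature0 hBp hBm) (quadratureS hr hBp hBm)
    (inner_monic_vector r hPhi)) => //.
  move=> x; rewrite shifted_walkE /quadrature /=.
  by rewrite scale0r addr0.
- by move=> k; apply: cvg_Re_inner; exact: cvg_iter_shifted_walk hBp hBm _ _ _.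
Unshelve. all: by end_near. Qed.
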